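(* Let $\xi$ be a complex random variable which is $C_\xi$-good for some $C_\xi \geq 1$. There exists a constant $C' \geq 1$, depending only on $C_\xi$, for which the following holds. For $\rho \in (0,1)$ let $$\boldsymbol{V}_\rho := \{\boldsymbol{v} \in (\mathbb{Z}+i\mathbb{Z})^n : \rho_{1,\xi}(\boldsymbol{v}) \geq \rho\}.$$ Let $n,s,k \in \mathbb{N}$ with $1000C_\xi \leq k \leq \sqrt{s} \leq s \leq n/\log n$. If $\rho \geq C'\max\{e^{-s/k}, s^{-k/4}\}$ and $p$ is an odd prime with $2^{n/s} \geq p \geq C'\rho^{-1}$, then $$|\varphi_p(\boldsymbol{V}_\rho)| \leq \left(\frac{5np^2}{s}\right)^s + \left(\frac{C'\rho^{-1}}{\sqrt{s/k}}\right)^n.$$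
   Context: A complex random variable $\xi$ is called $C$-good (for $C\geq 1$) if $\Pr(C^{-1} \leq |\xi_1 - \xi_2| \leq C) \geq C^{-1}$, where $\xi_1,\xi_2$ are independent copies of $\xi$. For $\boldsymbol{v} = (v_1,\dots,v_n)\in\mathbb{C}^n$ and $r\geq 0$, $\rho_{r,\xi}(\boldsymbol{v}) := \sup_{x \in \mathbb{C}}\Pr\left(v_1\xi_1 + \dots + v_n\xi_n \in B(x,r)\right)$, where $\xi_1,\dots,\xi_n$ are independent copies of $\xi$ and $B(x,r)$ is the disc of radius $r$ centered at $x$. The map $\varphi_p : (\mathbb{Z}+i\mathbb{Z})^n \to (\mathbb{F}_p + i\mathbb{F}_p)^n$ is the natural map reducing the real and imaginary parts of each coordinate modulo $p$. Logarithms are natural. *)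

(* Defs.v *)
From HB Require Import structures.
From mathcomp Require Import all_boot all_order all_algebra.
From mathcomp Require Import all_classical all_reals all_analysis.
From mathcomp Require Import complex.
Unset Printing Implicit Defensive.
Import Order.TTheory GRing.Theory Num.Theory.
Local Open Scope classical_set_scope.
Local Open Scope ring_scope.

Section Defs.
Context {R : realType} {d : measure_display} {Omega : measurableType d}.

Definition cpair (X : Omega -> R[i]) : Omega -> R * R :=
  fun w => (complex.Re (X w), complex.Im (X w)).

(* xi_0, xi_1, ... are measurable complex random variables that are mutually independent
   (every finite initial segment, hence every finite subfamily, satisfies the product rule
   for all Borel sets of C = R * R) and identically distributed *)
Definition iid_complex (P : probability Omega R) (xi : nat -> Omega -> R[i]) : Prop :=
  [/\ (forall j, measurable_fun setT (cpair (xi j))),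
      (forall (m : nat) (A : nat -> set (R * R)), (forall j, measurable (A j)) ->
         P (\bigcap_(j in [set j | (j < m)%N]) (cpair (xi j) @^-1` A j))
         = (\prod_(j < m) P (cpair (xi j) @^-1` A j))%E)
    & (forall (j : nat) (A : set (R * R)), measurable A ->
         P (cpair (xi j) @^-1` A) = P (cpair (xi 0%N) @^-1` A))].

Definition cnorm (z : R[i]) : R := Num.sqrt (complex.Re z ^+ 2 + complex.Im z ^+ 2).

(* C-good: Pr(C^-1 <= |xi_1 - xi_2| <= C) >= C^-1 for independent copies xi_1, xi_2 *)
Definition good (P : probability Omega R) (xi : nat -> Omega -> R[i]) (C : R) : Prop :=
  ((C^-1)%:E <= P [set w | (C^-1 <= cnorm (xi 0%N w - xi 1%N w) <= C)%R])%E.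

Definition gauss (z : int * int) : R[i] := (z.1%:~R +i* z.2%:~R)%C.

Definition small_ball (P : probability Omega R) (xi : nat -> Omega -> R[i])
    (n : nat) (r : R) (v : {ffun 'I_n -> int * int}) : \bar R :=
  ereal_sup [set P [set w | cnorm (\sum_(j < n) gauss (v j) * xi j w - x) <= r]
            | x in [set: R[i]]].

Definition Vrho (P : probability Omega R) (xi : nat -> Omega -> R[i])
    (n : nat) (rho : R) : set {ffun 'I_n -> int * int} :=
  [set v | (rho%:E <= small_ball P xi n 1 v)%E].

End Defs.

Definition phi_p (p n : nat) (v : {ffun 'I_n -> int * int}) : {ffun 'I_n -> 'F_p * 'F_p} :=
  [ffun j => ((v j).1%:~R, (v j).2%:~R)].

Definition phi_image (p n : nat) (A : set {ffun 'I_n -> int * int}) : {set {ffun 'I_n -> 'F_p * 'F_p}} :=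
  [set w | `[< exists2 v, A v & phi_p p n v = w >] ].

(* Main.v *)
(** Discretising [xi] turns the small ball probability of [sum v_j xi_j] into a finite sum. A
    nonnegative kernel [K] with nonnegative Fourier coefficients dominates the indicator of the
    disc; since [|phi| <= exp (- (1 - |phi|^2) / 2)] for characteristic functions, Jensen's
    inequality replaces the symmetrised variable by a single dilation [z] in an annulus, and
    [E K (sum v_j xi_j - x)] is at most an average over [z] of [E K (z * sum v_j Y_j)] with [Y_j]
    lazy signs. The [v_j] being Gaussian integers, this is at most a constant times the return
    probability of the walk [sum v_j Y_j] modulo [p], that is, an average over [t] in [F_p^2] of
    [exp (- lam * f t)] with [f t = sum_j (1 - cos (2 pi <t, v_j> / p))].

    For the Halász step, [sqrt f] is subadditive. A sublevel set of [f] with more than [p] elements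
    generates [F_p^2], so walking with small steps from [0] to a point where [f] is large meets
    every intermediate level, and translates of the sublevel set pack: [|{f <= M^2 x}|] grows at
    least linearly in [M]. Hence the return probability is at most a constant times
    [1 / p + sqrt (k / m) * avg (h / m)^(2k) + exp (- m / k)], where [h = sum_j cos] runs over any
    [m >= s] indices in the support of [v] modulo [p].

    So, if [rho] is large, every restriction of [v] modulo [p] to more than [s] indices of its
    support has many relations [v_i = +- v_(j_1) +- ... +- v_(j_(2k-1))] with all [j_l != i].
    Such a relation determines one coordinate from the others, and a double count, removing one
    coordinate at a time, bounds the number of such vectors. *)
Require Import Defs.
From HB Require Import structures.
From mathcomp Require Import all_boot all_order all_algebra.
From mathcomp Require Import all_classical all_reals all_analysis.
From mathcomp Require Import complex measurable_realfun.
From mathcomp Require Import ring lra zify.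
Import Order.TTheory GRing.Theory Num.Theory.
Import numFieldNormedType.Exports.
Local Open Scope classical_set_scope.
Local Open Scope ring_scope.

(** * The periodic kernel *)

Lemma sin_ge_mul_cos {R : realType} (y : R) : 0 <= y <= 1 -> y * cos y <= sin y <= y.
Proof.
case/andP; rewrite le_eqVlt => /orP[/eqP <-|y0] y1.
  by rewrite mul0r sin0 lexx.
have pi2 := @pi_ge2 R.
have [c cy] : exists2 c, c \in `]0, y[ & sin y - sin 0 = cos c * (y - 0).
  apply: MVT => // x; by apply: continuous_subspaceT => ?; exact: continuous_sin.
rewrite sin0 !subr0 => ->; move: cy; rewrite in_itv/= => /andP[c0 cy].
apply/andP; split; last by rewrite ler_piMl ?cos_le1 ?ltW.
rewrite mulrC ler_wpM2r ?(ltW y0)//.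
by rewrite ltW// ltr_cos// in_itv/=; lra.
Qed.

Lemma cos_ge1Bsqr {R : realType} (y : R) : `|y| <= 1 -> 1 - y ^+ 2 / 2 <= cos y.
Proof.
rewrite -cos_norm -[y ^+ 2]real_normK ?num_real//; move: `|y| (normr_ge0 y) => {}y y0 y1.
have {2}-> : y = (y / 2) *+ 2 by rewrite mulr2n; field.
rewrite cos_mulr2n cos2sin2.
have /andP[h1 h2] := @sin_ge_mul_cos R (y / 2) ltac:(lra).
have c0 : 0 <= cos (y / 2) by apply: cos_ge0_pihalf; have := @pihalf_ge1 R; lra.
have s0 : 0 <= y / 2 * cos (y / 2) by rewrite mulr_ge0//; lra.
have : sin (y / 2) ^+ 2 <= (y / 2) ^+ 2 by rewrite lerXn2r ?nnegrE//; lra.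
have -> : (y / 2) ^+ 2 = y ^+ 2 / 4 by field.
rewrite [(_ - _) *+ 2]mulr2n; lra.
Qed.

Lemma sqr_cos_le {R : realType} (y : R) : `|y| <= 1 -> cos y ^+ 2 * (1 + y ^+ 2) <= 1.
Proof.
rewrite -cos_norm -[y ^+ 2]real_normK ?num_real//; move: `|y| (normr_ge0 y) => {}y y0 y1.
have /andP[h1 h2] := @sin_ge_mul_cos R y ltac:(lra).
have c0 : 0 <= cos y by apply: cos_ge0_pihalf; have := @pihalf_ge1 R; lra.
have yc0 : 0 <= y * cos y by rewrite mulr_ge0.
have : (y * cos y) ^+ 2 <= sin y ^+ 2 by rewrite lerXn2r ?nnegrE//; lra.
rewrite sin2cos2 exprMn; lra.
Qed.

Lemma bernoulli_ge {R : realType} (x : R) n : -1 <= x -> 1 + n%:R * x <= (1 + x) ^+ n.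
Proof.
move=> x1; elim: n => [|n IH]; first by rewrite mul0r addr0 expr0.
rewrite exprS; apply: (@le_trans _ _ ((1 + x) * (1 + n%:R * x))); last first.
  by rewrite ler_wpM2l//; lra.
rewrite -natr1; have : 0 <= n%:R * x ^+ 2 by rewrite mulr_ge0 ?sqr_ge0.
nra.
Qed.

Lemma expRN_le_chord {R : realType} (y : R) : 0 <= y <= 1 -> expR (- y) <= 1 - y / 2.
Proof.
move=> /andP[y0 y1]; rewrite expRN -div1r ler_pdivrMr ?expR_gt0//.
have := expR_ge1Dx y; nra.
Qed.

(** A periodic substitute for the Gaussian exp (- |u|^2 / 32): being a power of cosines, it is a
    finite cosine sum with nonnegative coefficients. [N] is later taken so large that all arguments
    that occur satisfy |u_i| <= 8 N. *)
Definition kern {R : realType} (N : nat) (u : R * R) : R :=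
  (cos (u.1 / (8 * N%:R)) * cos (u.2 / (8 * N%:R))) ^+ (4 * N ^ 2).

Lemma kern_ge0 {R : realType} N (u : R * R) : 0 <= kern N u.
Proof. by rewrite /kern mulnC exprM (_ : 4 = 2 * 2)%N// exprM sqr_ge0. Qed.

Lemma kern_ge_half {R : realType} N (u : R * R) : (0 < N)%N ->
  `|u.1| <= 2 -> `|u.2| <= 2 -> 1 / 2 <= kern N u.
Proof.
move=> N0 u1 u2.
have N1 : 1 <= N%:R :> R by rewrite ler1n.
(* By Bernoulli: the cosine is at least 1 - 1 / (32 N^2), hence its power 4 N^2 at least 1 - 1/8.
   The product of two such factors exceeds 1/2. *)
have C (x : R) : `|x| <= 2 -> 7 / 8 <= cos (x / (8 * N%:R)) ^+ (4 * N ^ 2).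
  move=> x2.
  have d1 : `|x / (8 * N%:R)| <= 1 / (4 * N%:R).
    rewrite normrM normfV (@ger0_norm _ (8 * _)); last by nra.
    rewrite ler_pdivrMr; last by nra.
    apply: (le_trans x2); rewrite le_eqVlt; apply/orP; left; apply/eqP; field; lra.
  have e1 : 1 / (4 * N%:R) <= 1 :> R by rewrite ler_pdivrMr; lra.
  have h1 := cos_ge1Bsqr _ (le_trans d1 e1).
  have h2 : (x / (8 * N%:R)) ^+ 2 <= (1 / (4 * N%:R)) ^+ 2.
    by rewrite -[leLHS]real_normK ?num_real// lerXn2r ?nnegrE// divr_ge0//; lra.
  have e2 : (1 / (4 * N%:R)) ^+ 2 <= 1 :> R.
    by rewrite exprn_ile1// divr_ge0//; lra.
  have h3 : 1 + (- ((1 / (4 * N%:R)) ^+ 2 / 2)) <= cos (x / (8 * N%:R)) by lra.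
  apply: (@le_trans _ _ ((1 + (- ((1 / (4 * N%:R)) ^+ 2 / 2))) ^+ (4 * N ^ 2))); last first.
    rewrite lerXn2r ?nnegrE//; last by apply: le_trans h3; lra.
    lra.
  apply: le_trans (bernoulli_ge _ _ _); last lra.
  rewrite natrM natrX le_eqVlt; apply/orP; left; apply/eqP; field; lra.
rewrite /kern exprMn; have := C _ u1; have := C _ u2; nra.
Qed.

(** For a = u_1 / (8 N) and b = u_2 / (8 N), [sqr_cos_le] gives cos^2 a cos^2 b (1 + a^2 + b^2) <=
    1; raise this to the power N^2, apply Bernoulli and square. The final square lets the bound
    split into two one-dimensional weights, each summable over the integers. *)
Lemma kern_le {R : realType} N (u : R * R) : (0 < N)%N ->
  `|u.1| <= 8 * N%:R -> `|u.2| <= 8 * N%:R ->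
  kern N u * (1 + (u.1 ^+ 2 + u.2 ^+ 2) / 64) ^+ 2 <= 1.
Proof.
move=> N0 u1 u2.
have N1 : 1 <= N%:R :> R by rewrite ler1n.
set a := u.1 / (8 * N%:R); set b := u.2 / (8 * N%:R).
have le1 (x : R) : `|x| <= 8 * N%:R -> `|x / (8 * N%:R)| <= 1.
  move=> h; rewrite normrM normfV (@ger0_norm _ (8 * _)); last by nra.
  by rewrite ler_pdivrMr; nra.
have ha := sqr_cos_le _ (le1 _ u1); have hb := sqr_cos_le _ (le1 _ u2).
rewrite -/a -/b in ha hb.
have h1 : (cos a ^+ 2 * cos b ^+ 2) * (1 + (a ^+ 2 + b ^+ 2)) <= 1.
  apply: (@le_trans _ _ ((cos a ^+ 2 * (1 + a ^+ 2)) * (cos b ^+ 2 * (1 + b ^+ 2)))).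
    have := sqr_ge0 (cos a * cos b * a * b); nra.
  have a0 : 0 <= cos a ^+ 2 * (1 + a ^+ 2) by rewrite mulr_ge0 ?sqr_ge0// addr_ge0 ?sqr_ge0.
  have b0 : 0 <= cos b ^+ 2 * (1 + b ^+ 2) by rewrite mulr_ge0 ?sqr_ge0// addr_ge0 ?sqr_ge0.
  by rewrite -[leRHS]mulr1 ler_pM.
have e : 1 + (u.1 ^+ 2 + u.2 ^+ 2) / 64 <= (1 + (a ^+ 2 + b ^+ 2)) ^+ (N ^ 2).
  apply: le_trans (bernoulli_ge _ _ _); last by have := sqr_ge0 a; have := sqr_ge0 b; lra.
  rewrite natrX le_eqVlt; apply/orP; left; apply/eqP; rewrite /a /b; field; lra.
have s0 : 0 <= 1 + (u.1 ^+ 2 + u.2 ^+ 2) / 64.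
  by have := sqr_ge0 u.1; have := sqr_ge0 u.2; lra.
have ek : kern N u = (cos a ^+ 2 * cos b ^+ 2) ^+ (N ^ 2) ^+ 2.
  by rewrite /kern -/a -/b -!exprMn -!exprM; congr (_ ^+ _); rewrite (_ : 4 = 2 * 2)%N//; lia.
rewrite ek -exprMn -[leRHS](expr1n _ 2) lerXn2r ?nnegrE//.
  by rewrite mulr_ge0// exprn_ge0// mulr_ge0 ?sqr_ge0.
apply: (@le_trans _ _ (((cos a ^+ 2 * cos b ^+ 2) * (1 + (a ^+ 2 + b ^+ 2))) ^+ (N ^ 2))).
  by rewrite [leRHS]exprMn ler_wpM2l// exprn_ge0// mulr_ge0 ?sqr_ge0.
have := sqr_ge0 a; have := sqr_ge0 b => b0 a0.
have := sqr_ge0 (cos a); have := sqr_ge0 (cos b) => cb0 ca0.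
apply: exprn_ile1 => //; nra.
Qed.

(** * Characters of F_p^2 *)

Section Expi.
Context {R : realType}.

Definition expi (x : R) : R[i] := (cos x +i* sin x)%C.

Lemma expiD x y : expi (x + y) = expi x * expi y.
Proof. by rewrite /expi cosD sinD; apply/eqP; rewrite eq_complex/= eqxx addrC eqxx. Qed.

Lemma expi0 : expi 0 = 1.
Proof. by rewrite /expi cos0 sin0. Qed.

Lemma expi_sum (I : Type) (r : seq I) (P : pred I) (F : I -> R) :
  expi (\sum_(i <- r | P i) F i) = \prod_(i <- r | P i) expi (F i).
Proof. exact: (big_morph _ expiD expi0). Qed.

Lemma expi_2pi_nat (m : nat) : expi (2 * pi * m%:R) = 1.
Proof.
have e : 2 * pi * m%:R = 0 + (pi *+ 2) *+ m :> R.
  by rewrite add0r -[RHS]mulr_natr [pi *+ 2]mulr2n; ring.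
rewrite /expi e (periodicn (@cosD2pi R)) (periodicn (@sinD2pi R)).
by rewrite cos0 sin0.
Qed.

Lemma ReD (x y : R[i]) : complex.Re (x + y) = complex.Re x + complex.Re y.
Proof. by case: x; case: y. Qed.

Lemma ImD (x y : R[i]) : complex.Im (x + y) = complex.Im x + complex.Im y.
Proof. by case: x; case: y. Qed.

Lemma Re_sum (I : Type) (r : seq I) (P : pred I) (F : I -> R[i]) :
  complex.Re (\sum_(i <- r | P i) F i) = \sum_(i <- r | P i) complex.Re (F i).
Proof. exact: (big_morph _ ReD). Qed.

Lemma Im_sum (I : Type) (r : seq I) (P : pred I) (F : I -> R[i]) :
  complex.Im (\sum_(i <- r | P i) F i) = \sum_(i <- r | P i) complex.Im (F i).
Proof. exact: (big_morph _ ImD). Qed.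

Lemma ReZ (a : R) (x : R[i]) : complex.Re (a%:C%C * x) = a * complex.Re x.
Proof. by case: x => x y /=; rewrite mul0r subr0. Qed.

Lemma ImZ (a : R) (x : R[i]) : complex.Im (a%:C%C * x) = a * complex.Im x.
Proof. by case: x => x y /=; rewrite mul0r addr0. Qed.

Lemma real_complex_prod (I : Type) (r : seq I) (P : pred I) (F : I -> R) :
  (\prod_(i <- r | P i) F i)%:C%C = \prod_(i <- r | P i) (F i)%:C%C.
Proof. exact: (big_morph _ (rmorphM (real_complex R)) (rmorph1 (real_complex R))). Qed.

(** Independence: with [w j] as the law of the j-th choice, the mean of the exponential factors into
    characteristic functions. *)
Lemma sum_prod_cos (n : nat) (T : finType) (w al : 'I_n -> T -> R) (x : R) :
  \sum_(c : {ffun 'I_n -> T}) (\prod_j w j (c j)) * cos (\sum_j al j (c j) + x)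
  = complex.Re (expi x * \prod_j \sum_c (w j c)%:C%C * expi (al j c)).
Proof.
rewrite bigA_distr_bigA mulr_sumr Re_sum; apply: eq_bigr => c _.
rewrite big_split/= -real_complex_prod -expi_sum mulrCA -expiD ReZ/=.
by rewrite [x + _]addrC.
Qed.

Lemma normc_prod (I : Type) (r : seq I) (P : pred I) (F : I -> R[i]) :
  ComplexField.Normc.normc (\prod_(i <- r | P i) F i)
  = \prod_(i <- r | P i) ComplexField.Normc.normc (F i).
Proof.
apply: (big_morph _ (@ComplexField.Normc.normcM R)).
exact: ComplexField.Normc.normc1.
Qed.

Lemma normc_expi x : ComplexField.Normc.normc (expi x) = 1.
Proof. by rewrite /= cos2Dsin2 sqrtr1. Qed.

Lemma Re_le_normc (z : R[i]) : complex.Re z <= ComplexField.Normc.normc z.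
Proof.
case: z => a b /=; apply: (le_trans (ler_norm a)).
by rewrite -sqrtr_sqr ler_wsqrtr// lerDl sqr_ge0.
Qed.
End Expi.

Section Char.
Context {R : realType} (p : nat) (p_pr : prime p).
Local Notation F := ('F_p * 'F_p)%type.

Definition ep (x : 'F_p) : R[i] := expi (2 * pi * (x : nat)%:R / p%:R).

Let p0 : p%:R != 0 :> R.
Proof. by rewrite pnatr_eq0 -lt0n prime_gt0. Qed.

Lemma expi_modp (m : nat) : expi (2 * pi * m%:R / p%:R) = expi (2 * pi * (m %% p)%:R / p%:R) :> R[i].
Proof.
rewrite {1}(divn_eq m p) natrD natrM.
have -> : 2 * pi * ((m %/ p)%:R * p%:R + (m %% p)%:R) / p%:R
   = 2 * pi * (m %/ p)%:R + 2 * pi * (m %% p)%:R / p%:R :> R by field.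
by rewrite expiD expi_2pi_nat mul1r.
Qed.

Lemma ep_nat (m : nat) : ep m%:R = expi (2 * pi * m%:R / p%:R).
Proof. by rewrite [RHS]expi_modp /ep val_Fp_nat. Qed.

Lemma ep0 : ep 0 = 1.
Proof. by rewrite (ep_nat 0) mulr0 mul0r expi0. Qed.

Lemma epD x y : ep (x + y) = ep x * ep y.
Proof.
rewrite -[x]natr_Zp -[y]natr_Zp -natrD !ep_nat natrD -expiD; congr expi; ring.
Qed.

Lemma epN x : ep (- x) * ep x = 1.
Proof. by rewrite -epD addNr ep0. Qed.

Lemma ep_sum (I : Type) (r : seq I) (P : pred I) (G : I -> 'F_p) :
  ep (\sum_(i <- r | P i) G i) = \prod_(i <- r | P i) ep (G i).
Proof. exact: (big_morph _ epD ep0). Qed.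

(** Translation by 1 multiplies the sum by [ep 1], which is not 1. *)
Lemma sum_ep : \sum_(x : 'F_p) ep x = 0.
Proof.
have e1 : ep 1 != 1.
  rewrite (ep_nat 1); apply/negP => /eqP [c1 _].
  have p2 : 2 <= p%:R :> R by rewrite (ler_nat _ 2) prime_gt1.
  have pi0 := @pi_gt0 R.
  have : cos (2 * pi * 1 / p%:R) < cos 0 :> R.
    rewrite ltr_cos// ?in_itv/= ?lexx ?pi_ge0//.
      by rewrite divr_gt0//; nra.
    by rewrite divr_ge0//= ?ler_pdivrMr; nra.
  by rewrite cos0 c1 ltxx.
have h : (\sum_(x : 'F_p) ep x) * ep 1 = \sum_(x : 'F_p) ep x.
  rewrite mulr_suml (reindex_inj (addIr (-1 : 'F_p)))/=.
  by apply: eq_bigr => x _; rewrite -epD subrK.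
apply/eqP; have : (\sum_(x : 'F_p) ep x) * (ep 1 - 1) = 0.
  by rewrite mulrBr h mulr1 subrr.
by move/eqP; rewrite mulf_eq0 subr_eq0 (negbTE e1) orbF.
Qed.

Definition dot (t a : F) : 'F_p := t.1 * a.1 + t.2 * a.2.

Lemma dotC t a : dot t a = dot a t.
Proof. by rewrite /dot mulrC [t.2 * _]mulrC. Qed.

Lemma dotDr t a b : dot t (a + b) = dot t a + dot t b.
Proof. by rewrite /dot !mulrDr addrACA. Qed.

Lemma dotNr t a : dot t (- a) = - dot t a.
Proof. by rewrite /dot !mulrN opprD. Qed.

Lemma dot0r t : dot t 0 = 0.
Proof. by rewrite /dot !mulr0 addr0. Qed.

Lemma dot_sumr (I : Type) (r : seq I) (P : pred I) (G : I -> F) t :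
  dot t (\sum_(i <- r | P i) G i) = \sum_(i <- r | P i) dot t (G i).
Proof. exact: (big_morph _ (dotDr t) (dot0r t)). Qed.

Lemma sum_ep_mul (b c : 'F_p) : b != 0 -> \sum_(x : 'F_p) ep (x * b + c) = 0.
Proof.
move=> b0; transitivity ((\sum_(x : 'F_p) ep x) * ep c); last by rewrite sum_ep mul0r.
rewrite mulr_suml [RHS](reindex_inj (mulIf b0))/=.
by apply: eq_bigr => x _; rewrite epD.
Qed.

Lemma sum_ep_dot (a : F) :
  \sum_(t : F) ep (dot t a) = if a == 0 then (p%:R ^+ 2) else 0.
Proof.
have [->|a0] := eqVneq a 0.
  under eq_bigr do rewrite dot0r ep0.
  by rewrite sumr_const card_prod card_Fp// natrM expr2.
rewrite -(pair_bigA _ (fun t1 t2 => ep (t1 * a.1 + t2 * a.2)))/=.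
have [a1|a1] := eqVneq a.1 0.
  have a2 : a.2 != 0 by apply: contraNneq a0 => a2; case: (a) a1 a2 => /= ? ? -> ->.
  by rewrite big1// => t1 _; under eq_bigr do rewrite addrC; rewrite sum_ep_mul.
by rewrite exchange_big big1// => t2 _; rewrite sum_ep_mul.
Qed.

Definition ch (t a : F) : R := complex.Re (ep (dot t a)).
Definition favg (g : F -> R) : R := (\sum_(t : F) g t) / p%:R ^+ 2.

Lemma chC t a : ch t a = ch a t.
Proof. by rewrite /ch dotC. Qed.

Lemma ch_le1 t a : ch t a <= 1. Proof. exact: cos_le1. Qed.

Lemma ch_norm_le1 t a : `|ch t a| <= 1. Proof. exact: cos_max. Qed.

Lemma ch0 t : ch t 0 = 1.
Proof. by rewrite /ch dot0r ep0. Qed.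

Lemma ep_conj x : ep (- x) = (ep x)^*%C.
Proof.
have h : ep x * (ep x)^*%C = 1.
  rewrite /ep /expi /=; apply/eqP; rewrite eq_complex/=.
  by rewrite mulrN opprK -!expr2 cos2Dsin2 eqxx/= mulrN addrC mulrC subrr.
by rewrite -[LHS]mulr1 -h mulrA epN mul1r.
Qed.

Lemma chN t a : ch t (- a) = ch t a.
Proof. by rewrite /ch dotNr ep_conj; case: (ep (dot t a)). Qed.

Lemma chDB t a b : ch t (a + b) + ch t (a - b) = 2 * (ch t a * ch t b).
Proof.
rewrite /ch !dotDr dotNr (epD (dot t a) (dot t b)) (epD (dot t a) (- dot t b)).
rewrite ep_conj; case: (ep (dot t a)) => a1 a2; case: (ep (dot t b)) => b1 b2 /=.
ring.
Qed.

(** 1 - cos behaves like a squared norm: compare (A + B)^2 <= (1 + e) A^2 + (1 + 1/e) B^2. With u =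
    1 - cos x and w = 1 - cos y, the left side is u + w - u w + sin x sin y, and |sin x sin y| <= 2
    sqrt (u w) <= e u + w / e. This form, unlike a bound on square roots, can be summed over
    coordinates. *)
Lemma ch_subadd t a b (e : R) : 0 < e ->
  1 - ch t (a + b) <= (1 + e) * (1 - ch t a) + (1 + e^-1) * (1 - ch t b).
Proof.
move=> e0; rewrite /ch dotDr (epD (dot t a) (dot t b)) /ep /expi /=.
move: (2 * _ * _ / _) => x; move: (2 * _ * _ / _) => y.
have := cos2Dsin2 x; have := cos2Dsin2 y.
have := cos_le1 x; have := cos_geN1 x; have := cos_le1 y; have := cos_geN1 y.
move: (cos x) (sin x) (cos y) (sin y) => cx sx cy sy y1 y2 x1 x2 ey ex.
set u := 1 - cx; set w := 1 - cy.
have u0 : 0 <= u by rewrite /u; lra.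
have w0 : 0 <= w by rewrite /w; lra.
have h : (sx * sy) ^+ 2 <= (e * u + e^-1 * w) ^+ 2.
  have -> : (sx * sy) ^+ 2 = (u * (2 - u)) * (w * (2 - w)).
    have -> : u * (2 - u) = sx ^+ 2 by rewrite /u; lra.
    have -> : w * (2 - w) = sy ^+ 2 by rewrite /w; lra.
    by rewrite exprMn.
  apply: (@le_trans _ _ (4 * (u * w))).
    have uw := mulr_ge0 u0 w0.
    have u2 : 2 - u <= 2 by lra. have w2 : 2 - w <= 2 by lra.
    have u3 : 0 <= 2 - u by rewrite /u; lra. have w3 : 0 <= 2 - w by rewrite /w; lra.
    have : (2 - u) * (2 - w) <= 4 by nra.
    nra.
  have := sqr_ge0 (e * u - e^-1 * w).
  have : e * u * (e^-1 * w) = u * w by field; lra.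
  nra.
have h2 : `|sx * sy| <= e * u + e^-1 * w.
  have g0 : 0 <= e * u + e^-1 * w by rewrite addr_ge0// mulr_ge0 ?invr_ge0// ltW.
  by rewrite -(ger0_norm g0) -ler_sqr ?nnegrE ?normr_ge0// !real_normK ?num_real.
have := ler_norm (sx * sy).
have := mulr_ge0 u0 w0; rewrite /u /w in h2 *.
lra.
Qed.

Lemma sum_ch_dot (a : F) : \sum_(t : F) ch t a = if a == 0 then (p%:R ^+ 2) else 0.
Proof.
rewrite /ch -Re_sum sum_ep_dot; case: ifP => //= _.
by rewrite -[p%:R](rmorph_nat (real_complex R)) -rmorphXn.
Qed.

Lemma favg_ch (a : F) : favg (fun t => ch t a) = (a == 0)%:R.
Proof.
by rewrite /favg sum_ch_dot; case: ifP => _; rewrite ?mul0r// divff// expf_neq0.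
Qed.
End Char.

(** * An inequality for powers of sums of cosines *)

Section Pt.
Context {R : realType}.

Lemma subX_norm_le (x y H : R) n : `|x| <= H -> `|y| <= H -> `|x - y| <= 1 ->
  `|x ^+ n.+1 - y ^+ n.+1| <= n.+1%:R * H ^+ n.
Proof.
move=> xH yH xy; rewrite subrXX normrM.
apply: (@le_trans _ _ (1 * \sum_(i < n.+1) H ^+ n)); last first.
  by rewrite mul1r sumr_const card_ord mulr_natl.
have H0 := le_trans (normr_ge0 x) xH.
apply: ler_pM => //; apply: (le_trans (ler_norm_sum _ _ _)); apply: ler_sum => i _.
rewrite normrM !normrX.
have -> : H ^+ n = H ^+ (n.+1.-1 - i) * H ^+ i by rewrite -exprD /= subnK// -ltnS.
by apply: ler_pM; rewrite ?exprn_ge0// lerXn2r ?nnegrE.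
Qed.

(* h^{2k} dominates unless |h| is of order sqrt (k m). *)
Lemma sum_cos_power_ge (I : finType) (J : {set I}) (c : I -> R) (k : nat) :
  (0 < k)%N -> (k <= #|J|)%N -> (forall i, `|c i| <= 1) ->
  let h := \sum_(i in J) c i in
  h ^+ (2 * k) / 2 - (16 * k%:R * #|J|%:R) ^+ k
    <= \sum_(i in J) c i * (h - c i) ^+ (2 * k).-1.
Proof.
move=> k0 kJ c1; set h := \sum_(i in J) c i; rewrite -/h; set m := #|J|%:R : R.
have k1 : 1 <= k%:R :> R by rewrite ler1n.
have km : k%:R <= m by rewrite ler_nat.
pose H := `|h| + 1.
have H1 : 1 <= H by rewrite /H lerDr.
case: k k0 kJ k1 km => // k _ kJ k1 km.
have e2k : ((2 * k.+1).-1 = (2 * k).+1)%N by lia.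
(* Write K for [k.+1]. Then h^(2K) is the sum of the c_i h^(2K-1), and replacing h by h - c_i costs
   at most (2K-1) H^(2K-2) per term. *)
have step : h ^+ (2 * k.+1) - m * ((2 * k).+1%:R * H ^+ (2 * k))
   <= \sum_(i in J) c i * (h - c i) ^+ (2 * k.+1).-1.
  rewrite e2k.
  have -> : h ^+ (2 * k.+1) = \sum_(i in J) c i * h ^+ (2 * k).+1.
    by rewrite -mulr_suml -/h -exprS; congr (_ ^+ _); lia.
  have -> : m * ((2 * k).+1%:R * H ^+ (2 * k)) = \sum_(i in J) (2 * k).+1%:R * H ^+ (2 * k).
    by rewrite sumr_const -[RHS]mulr_natl.
  rewrite -sumrB; apply: ler_sum => i _.
  rewrite lerBlDr -lerBlDl -mulrBr; apply: (le_trans (ler_norm _)).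
  rewrite normrM -[leRHS]mul1r; apply: ler_pM => //.
  have hH : `|h| <= H by rewrite /H lerDl.
  apply: subX_norm_le => //.
    by apply: (le_trans (ler_normB _ _)); rewrite lerD2l.
  by rewrite opprB addrCA subrr addr0.
apply: le_trans step.
have M : m * (2 * k).+1%:R <= 2 * k.+1%:R * m.
  have : (2 * k).+1%:R <= (2 * k.+1)%:R :> R by rewrite ler_nat; lia.
  rewrite natrM; nra.
have m0 : 0 <= m by lra.
have P0 : 0 <= H ^+ (2 * k) by rewrite exprn_ge0//; lra.
have Hh : `|h| ^+ (2 * k.+1) = h ^+ (2 * k.+1) by rewrite exprM real_normK ?num_real// -exprM.
have hh0 : 0 <= h ^+ (2 * k.+1) by rewrite -Hh exprn_ge0.
have eH : H ^+ (2 * k.+1) = H ^+ 2 * H ^+ (2 * k) by rewrite -exprD; congr (_ ^+ _); lia.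
(* If H^2 is small, the subtracted term absorbs the whole error. Otherwise H > 4K, so |h| = H - 1
   still gives h^(2K) >= H^(2K) / 2, and the error is at most H^(2K) / 8. *)
have [small|big] := leP (H ^+ 2) (16 * k.+1%:R * m).
  have h1 : H ^+ (2 * k) <= (16 * k.+1%:R * m) ^+ k.
    by rewrite exprM lerXn2r ?nnegrE ?sqr_ge0//; nra.
  have h2 : m * ((2 * k).+1%:R * H ^+ (2 * k)) <= (16 * k.+1%:R * m) ^+ k.+1.
    rewrite mulrA; apply: (@le_trans _ _ ((2 * k.+1%:R * m) * H ^+ (2 * k))).
      by rewrite ler_wpM2r.
    rewrite exprS; apply: ler_pM => //; nra.
  lra.
have y4 : 4 * k.+1%:R < H by nra.
have hE : H * (1 + - (1 / H)) = `|h| by rewrite /H; field; rewrite -/H; lra.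
have iH : 1 / H <= 1 by rewrite ler_pdivrMr; lra.
have low : H ^+ (2 * k.+1) / 2 <= h ^+ (2 * k.+1).
  rewrite -Hh -hE exprMn ler_wpM2l//; first by rewrite exprn_ge0//; lra.
  apply: (@le_trans _ _ (1 + (2 * k.+1)%:R * (- (1 / H)))).
    suff : (2 * k.+1)%:R * (1 / H) <= 1 / 2 by lra.
    by rewrite natrM mul1r ler_pdivrMr; lra.
  by apply: bernoulli_ge; lra.
have err : m * ((2 * k).+1%:R * H ^+ (2 * k)) <= H ^+ (2 * k.+1) / 8.
  rewrite mulrA eH; apply: (@le_trans _ _ ((2 * k.+1%:R * m) * H ^+ (2 * k))).
    by rewrite ler_wpM2r.
  rewrite [leRHS]mulrAC ler_wpM2r//; nra.
have e0 : 0 <= (16 * k.+1%:R * m) ^+ k.+1 by rewrite exprn_ge0//; nra.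
nra.
Qed.
End Pt.

(** * Counting vectors with many relations *)

Section Count.
Local Open Scope set_scope.
Local Open Scope ring_scope.
Context {R : realType} (p : nat) (p_pr : prime p) (n : nat).
Local Notation F := ('F_p * 'F_p)%type.
Local Notation vec := {ffun 'I_n -> F}.

(* #|J|^-r * nrep J r a x is the probability that a sum of r independent uniform elements of
   { +- a_j : j in J } equals x. *)
Definition nrep (J : {set 'I_n}) (r : nat) (a : vec) (x : F) : R :=
  favg p (fun t => ch p t x * (\sum_(j in J) ch p t (a j)) ^+ r).

(** One step of the walk, by the product formula for cosines. This recursion shows nonnegativity,
    which the Fourier form hides. *)
Lemma nrepS J r a x : nrep J r.+1 a x
  = \sum_(j in J) (nrep J r a (x + a j) + nrep J r a (x - a j)) / 2.
Proof.
rewrite /nrep /favg.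
have e j : ((\sum_t ch p t (x + a j) * (\sum_(j in J) ch p t (a j)) ^+ r) / p%:R ^+ 2 +
    (\sum_t ch p t (x - a j) * (\sum_(j in J) ch p t (a j)) ^+ r) / p%:R ^+ 2) / 2
    = (\sum_t ch p t x * ch p t (a j) * (\sum_(j in J) ch p t (a j)) ^+ r) / p%:R ^+ 2 :> R.
  rewrite -mulrDl -big_split/= mulrAC mulr_suml; congr (_ / _); apply: eq_bigr => t _.
  by rewrite -mulrDl chDB//; field.
under [in RHS]eq_bigr do rewrite e.
rewrite -[RHS]mulr_suml exchange_big/=; congr (_ / _); apply: eq_bigr => t _.
by rewrite -[RHS]mulr_suml -mulr_sumr exprS mulrA.
Qed.

Lemma nrep_ge0 J r a x : 0 <= nrep J r a x.
Proof.
elim: r x => [|r IH] x; last first.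
  by rewrite nrepS sumr_ge0// => j _; rewrite divr_ge0// addr_ge0.
rewrite /nrep; under [X in favg _ X]eq_fun do rewrite expr0 mulr1.
by rewrite favg_ch// ler0n.
Qed.

(** By orthogonality only the frequency t = 0 survives, where every cosine is 1. *)
Lemma sum_nrep J r a : \sum_x nrep J r a x = #|J|%:R ^+ r.
Proof.
rewrite /nrep /favg -mulr_suml exchange_big/=.
have e (t : F) : \sum_x ch p t x = if t == 0 then p%:R ^+ 2 else 0 :> R.
  by rewrite -(sum_ch_dot _ p_pr); apply: eq_bigr => x _; rewrite chC.
under eq_bigr => t _ do rewrite -mulr_suml e.
have e2 (P : R) (G : F -> R) : \sum_(t : F) (if t == 0 then P else 0) * G t = P * G 0.
  rewrite (eq_bigr (fun t : F => if t == 0 then P * G t else 0)).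
    by rewrite -big_mkcond big_pred1_eq.
  by move=> t _; case: ifP => _ //; rewrite mul0r.
rewrite e2 mulrAC divff ?mul1r; last by rewrite expf_neq0// pnatr_eq0 -lt0n prime_gt0.
congr (_ ^+ _); under eq_bigr do rewrite chC ch0//.
by rewrite sumr_const.
Qed.

Lemma eq_nrep (J : {set 'I_n}) r (a b : vec) x : {in J, a =1 b} -> nrep J r a x = nrep J r b x.
Proof.
move=> ab; rewrite /nrep; congr favg; apply/funext => t; congr (_ * _ ^+ _).
by apply: eq_bigr => j jJ; rewrite ab.
Qed.

(** Inside [I], a random relation a_i = +- a_(j_1) +- ... +- a_(j_r) holds with probability roughly
    [theta] or more. Taking the j's in [I :\ i] lets the other coordinates determine [a i]; asking
    this of all large [I] makes the property survive the removal of an index. *)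
Definition bad (theta : R) (s r : nat) (J : {set 'I_n}) : {set vec} :=
  [set a : vec | [forall j, (j \notin J) ==> (a j == 0)] &&
    [forall I : {set 'I_n}, (I \subset J) && (s < #|I|)%N ==>
      (theta * #|I|%:R ^+ r.+1 <= \sum_(i in I) nrep (I :\ i) r a (a i))]].

Lemma card_supp_le (J : {set 'I_n}) :
  #|[set a : vec | [forall j, (j \notin J) ==> (a j == 0)]]| = ((p ^ 2) ^ #|J|)%N.
Proof.
have -> : (p ^ 2 = #|{: F}|)%N by rewrite card_prod card_Fp.
rewrite -(card_pffun_on (0 : F)); apply: eq_card => a; rewrite !inE.
apply/forallP/pffun_onP => [h|[h _] j].
  split => // ; apply/fintype.subsetP => j; rewrite !inE; apply: contraNT => jJ.
  by have /implyP := h j; apply.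
apply/implyP; apply: contraNT => aj.
by move/fintype.subsetP : h => /(_ j); apply; rewrite inE.
Qed.

Definition zero_at (i : 'I_n) (a : vec) : vec := [ffun j => if j == i then 0 else a j].

Lemma zero_at_bad theta s r J i a : a \in bad theta s r J -> zero_at i a \in bad theta s r (J :\ i).
Proof.
rewrite !inE => /andP[/forallP a0 /forallP aI]; apply/andP; split.
  apply/forallP => j; apply/implyP; rewrite !inE ffunE negb_and negbK.
  by case: eqP => //= _ jJ; have /implyP := a0 j; apply.
apply/forallP => I; apply/implyP => /andP[IJ sI].
have /implyP := aI I; rewrite sI (fintype.subset_trans IJ (subD1set _ _)) => /(_ isT) h.
apply: (le_trans h); rewrite le_eqVlt; apply/orP; left; apply/eqP.
have iI j : j \in I -> j == i = false.
  by move=> /(fintype.subsetP IJ); rewrite !inE => /andP[/negbTE].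
apply: eq_bigr => j jI; rewrite ffunE iI//; apply: eq_nrep => l.
by rewrite !inE => /andP[_ lI]; rewrite ffunE iI.
Qed.

(** A weighted double count of pairs (a, i). Each bad [a] has total weight at least theta |J|^(r+1).
    For fixed [i], [a] amounts to b = [zero_at i a] and x = [a i]; the weight depends on b and x
    alone, and its sum over x is at most |J|^r. *)
Lemma card_bad_step theta s r (J : {set 'I_n}) (B : R) : 0 < theta -> (s < #|J|)%N ->
  (forall i, i \in J -> #|bad theta s r (J :\ i)|%:R <= B) ->
  #|bad theta s r J|%:R <= B / theta.
Proof.
move=> th0 sJ hB; have J0 : 0 < #|J|%:R :> R by rewrite ltr0n (leq_ltn_trans _ sJ).
rewrite ler_pdivlMr//.
suff : #|bad theta s r J|%:R * (theta * #|J|%:R ^+ r.+1) <= B * #|J|%:R ^+ r.+1.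
  by rewrite mulrA ler_pM2r// exprn_gt0.
apply: (@le_trans _ _ (\sum_(a in bad theta s r J) \sum_(i in J) nrep (J :\ i) r a (a i))).
  rewrite mulr_natl -sumr_const; apply: ler_sum => a; rewrite inE => /andP[_ /forallP/(_ J)].
  by rewrite subxx sJ.
rewrite exchange_big/=.
apply: (@le_trans _ _ (\sum_(i in J) B * #|J|%:R ^+ r)); last first.
  by rewrite sumr_const exprSr mulrA -[leLHS]mulr_natr.
apply: ler_sum => i iJ.
apply: (@le_trans _ _ (\sum_(b in bad theta s r (J :\ i)) \sum_x nrep (J :\ i) r b x)); last first.
  under eq_bigr do rewrite sum_nrep.
  rewrite sumr_const -[leLHS]mulr_natl; apply: ler_pM => //.
    exact: hB.
  by rewrite lerXn2r ?nnegrE// ler_nat subset_leq_card// subD1set.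
rewrite (partition_big (zero_at i) (fun b => b \in bad theta s r (J :\ i)))/=; last first.
  by move=> a /zero_at_bad; apply.
apply: ler_sum => b _.
have e a : (a \in bad theta s r J) && (zero_at i a == b) ->
    nrep (J :\ i) r a (a i) = nrep (J :\ i) r b (a i).
  move=> /andP[_ /eqP <-]; apply: eq_nrep => j; rewrite !inE ffunE.
  by case/andP => /negbTE ->.
rewrite (eq_bigr _ e).
pose A := [set a in bad theta s r J | zero_at i a == b].
rewrite (eq_bigl (mem A)); last by move=> a; rewrite /A !inE.
(* Within a fibre of [zero_at i], the value [a i] determines [a], so the sum over the fibre is part
   of the sum over all x. *)
rewrite -(big_imset (nrep (J :\ i) r b) (h := fun a : vec => a i))/=; last first.
  move=> a a'; rewrite !inE => /andP[_ /eqP ab] /andP[_ /eqP ab'] aa'.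
  apply/ffunP => j; have [->//|ji] := eqVneq j i.
  have := congr1 (fun f : vec => f j) ab; rewrite -ab' !ffunE (negbTE ji) //.
rewrite [leRHS](bigID (mem ((fun a : vec => a i) @: A)))/= lerDl.
by apply: sumr_ge0 => x _; exact: nrep_ge0.
Qed.

(** Each removed index gains a factor 1 / theta; once [s] indices are left, all p^(2s) vectors are
    counted. *)
Lemma card_bad_le theta s r (J : {set 'I_n}) : 0 < theta -> (s <= #|J|)%N ->
  #|bad theta s r J|%:R <= p%:R ^+ (2 * s) / theta ^+ (#|J| - s).
Proof.
move=> th0; move e : (#|J| - s)%N => m; elim: m J e => [|m IH] J e sJ.
  have {}e : #|J| = s by lia.
  rewrite expr0 divr1 -natrX ler_nat expnM -{2}e -card_supp_le.
  by apply: subset_leq_card; apply/fintype.subsetP => a; rewrite !inE => /andP[].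
rewrite exprSr invfM mulrA; apply: card_bad_step => //; first by lia.
move=> i iJ; have := cardsD1 i J; rewrite iJ => c.
by apply: IH; lia.
Qed.

(** The probability of hitting the single value [a i] cannot exceed 1. This lets the final count
    assume theta <= 1. *)
Lemma bad_empty theta s r (J : {set 'I_n}) : 1 < theta -> (s < #|J|)%N -> bad theta s r J = finset.set0.
Proof.
move=> th1 sJ; apply/setP => a; rewrite [RHS]inE; apply/negbTE/negP.
rewrite inE => /andP[_ /forallP/(_ J)]; rewrite subxx sJ/=; apply/negP; rewrite -ltNge.
have J0 : 0 < #|J|%:R ^+ r.+1 :> R by rewrite exprn_gt0// ltr0n (leq_ltn_trans _ sJ).
apply: (@le_lt_trans _ _ (\sum_(i in J) #|J|%:R ^+ r)); last first.
  by rewrite sumr_const -[ltLHS]mulr_natr -exprSr ltr_pMl.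
apply: ler_sum => i iJ; apply: (@le_trans _ _ (\sum_x nrep (J :\ i) r a x)).
  by rewrite (bigD1 (a i))//= lerDl sumr_ge0// => x _; exact: nrep_ge0.
by rewrite sum_nrep lerXn2r ?nnegrE// ler_nat subset_leq_card// subD1set.
Qed.
End Count.

(** * Halász's inequality *)

Lemma cramer2 (K : fieldType) (u1 u2 v1 v2 t1 t2 : K) (dt := u1 * v2 - u2 * v1) : dt != 0 ->
  t1 = u1 * ((t1 * v2 - t2 * v1) / dt) + v1 * ((u1 * t2 - u2 * t1) / dt) /\
  t2 = u2 * ((t1 * v2 - t2 * v1) / dt) + v2 * ((u1 * t2 - u2 * t1) / dt).
Proof. by rewrite /dt => dt0; split; field. Qed.

Section Gen.
Local Open Scope set_scope.
Local Open Scope ring_scope.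
Context (p : nat) (p_pr : prime p).
Local Notation F := ('F_p * 'F_p)%type.

(** A line through 0 has only p elements, so [B] contains two linearly independent vectors;
    multiplication by an element of ['F_p] is a natural multiple. *)
Lemma big_set_generates (B : {set F}) : (p < #|B|)%N ->
  exists b1 b2, [/\ b1 \in B, b2 \in B &
    forall t : F, exists x y : nat, t = b1 *+ x + b2 *+ y].
Proof.
move=> pB.
have [b1 b1B b10] : exists2 b1, b1 \in B & b1 != 0.
  have : (0 < #|B :\ (0%R : F)|)%N.
    have p1 := prime_gt1 p_pr; move: pB; rewrite (cardsD1 (0%R : F) B).
    by case: (_ \in B); rewrite ?add1n ?add0n => ?; apply: leq_trans (ltnW p1) _; rewrite // ltnW.
  by case/card_gt0P => b; rewrite !inE => /andP[b0 bB]; exists b.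
pose L := [set ((x * b1.1, x * b1.2) : F) | x : 'F_p].
have [b2 b2B b2L] : exists2 b2, b2 \in B & b2 \notin L.
  have : ~~ (B \subset L).
    apply/negP => /subset_leq_card; rewrite leqNgt => /negP; apply.
    by apply: leq_ltn_trans pB; rewrite (leq_trans (leq_imset_card _ _))// card_Fp.
  by case/fintype.subsetPn => b bB bL; exists b.
exists b1, b2; split=> // t.
pose dt := b1.1 * b2.2 - b1.2 * b2.1.
have dt0 : dt != 0.
  apply: contra b2L; rewrite subr_eq0 => /eqP e; apply/imsetP.
  have [z1|z1] := eqVneq b1.1 0.
    have z2 : b1.2 != 0 by apply: contraNneq b10 => z2; case: (b1) z1 z2 => /= ? ? -> ->.
    exists (b2.2 / b1.2) => //; rewrite z1 mulr0 mulfVK//.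
    have : b1.2 * b2.1 == 0 by rewrite -e z1 mul0r.
    by rewrite mulf_eq0 (negbTE z2)/= => /eqP <-; rewrite -surjective_pairing.
  exists (b2.1 / b1.1) => //; rewrite mulfVK// mulrAC [b2.1 * _]mulrC -e mulrAC divff// mul1r.
  by rewrite -surjective_pairing.
have E (z : 'F_p) : exists k : nat, forall u, u *+ k = u * z.
  by exists z => u; rewrite -mulr_natr natr_Zp.
have [x xE] := E ((t.1 * b2.2 - t.2 * b2.1) / dt).
have [y yE] := E ((b1.1 * t.2 - b1.2 * t.1) / dt).
exists x, y; case: t xE yE => t1 t2; case: (b1) (b2) @dt dt0 => [u1 u2] [v1 v2] /= dt0 xE yE.
have pm (u v : 'F_p) k : (u, v) *+ k = (u *+ k, v *+ k) :> F.
  by elim: k => // k IH; rewrite !mulrS IH.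
by have [e1 e2] := cramer2 _ u1 u2 v1 v2 t1 t2 dt0; rewrite !pm !xE !yE; congr (_, _).
Qed.

Context {R : realType}.

(** * Growth of sublevel sets when the square root is subadditive *)

Section Pseudonorm.
Context (f : F -> R) (f_ge0 : forall t, 0 <= f t) (f0 : f 0 = 0)
  (fN : forall t, f (- t) = f t)
  (f_sub : forall (e : R) s t, 0 < e -> f (s + t) <= (1 + e) * f s + (1 + e^-1) * f t).

Lemma sqrt_subadd s t : Num.sqrt (f (s + t)) <= Num.sqrt (f s) + Num.sqrt (f t).
Proof.
set A := Num.sqrt (f s); set B := Num.sqrt (f t).
have A0 : 0 <= A := sqrtr_ge0 _; have B0 : 0 <= B := sqrtr_ge0 _.
rewrite -[leRHS](ger0_norm (addr_ge0 A0 B0)) -sqrtr_sqr ler_wsqrtr//.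
have fA : f s = A ^+ 2 by rewrite sqr_sqrtr.
have fB : f t = B ^+ 2 by rewrite sqr_sqrtr.
apply/ler_addgt0Pr => e e0.
pose d := e / (A + B + 1).
have d0 : 0 < d by rewrite divr_gt0//; lra.
have de : d * (A + B) <= e.
  by rewrite /d mulrAC ler_pdivrMr; nra.
(* The best weight is B / A; the shift by [d] keeps it defined and positive when A or B vanishes,
   and costs d (A + B) <= e. *)
have k0 : 0 < (B + d) / (A + d) by rewrite divr_gt0//; lra.
apply: (le_trans (f_sub _ s t k0)); rewrite fA fB invf_div.
have h1 : (B + d) / (A + d) * A ^+ 2 <= (B + d) * A.
  rewrite mulrAC ler_pdivrMr; last lra.
  by rewrite -mulrA ler_wpM2l//; [lra|nra].
have h2 : (A + d) / (B + d) * B ^+ 2 <= (A + d) * B.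
  rewrite mulrAC ler_pdivrMr; last lra.
  by rewrite -mulrA ler_wpM2l//; [lra|nra].
nra.
Qed.

Definition sublevel (x : R) : {set F} := [set t | f t <= x].

(** A discrete intermediate value theorem: [t] is reached from 0 by steps in the sublevel set, and
    each step raises sqrt f by at most r, so it cannot jump over ]y - r, y]. *)
Lemma sqrt_level_exists (r y : R) (t : F) : 0 < r -> (p < #|sublevel (r ^+ 2)|)%N ->
  r <= y -> y < Num.sqrt (f t) -> exists w, y - r < Num.sqrt (f w) <= y.
Proof.
move=> r0 pB ry yt; apply: contrapT => no.
have [b1 [b2 [h1 h2 gen]]] := big_set_generates _ pB.
have Br b : b \in sublevel (r ^+ 2) -> Num.sqrt (f b) <= r.
  by rewrite inE => h; rewrite -[leRHS](gtr0_norm r0) -sqrtr_sqr ler_wsqrtr.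
have step u b : b \in sublevel (r ^+ 2) -> Num.sqrt (f u) <= y - r -> Num.sqrt (f (u + b)) <= y - r.
  move=> /Br hb hu; rewrite leNgt; apply/negP => c; apply: no; exists (u + b).
  by rewrite c/=; have := sqrt_subadd u b; lra.
have stepn u b k : b \in sublevel (r ^+ 2) -> Num.sqrt (f u) <= y - r -> Num.sqrt (f (u + b *+ k)) <= y - r.
  move=> bB hu; elim: k => [|k IH]; first by rewrite mulr0n addr0.
  by rewrite mulrSr addrA; exact: step.
have [x [z tE]] := gen t.
have : Num.sqrt (f t) <= y - r.
  by rewrite tE -[_ *+ x]add0r; apply: (stepn _) => //; apply: (stepn _) => //; rewrite f0 sqrtr0; lra.
lra.
Qed.

(* Translates of the ball of radius r centred at points of norm about 0, 3r, 6r, ... are disjoint. *)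
Lemma packing (r : R) (M : nat) (t : F) : 0 < r -> (p < #|sublevel (r ^+ 2)|)%N ->
  3 * r * M%:R < Num.sqrt (f t) ->
  (M.+1 * #|sublevel (r ^+ 2)| <= #|sublevel ((3 * r * M.+1%:R) ^+ 2)|)%N.
Proof.
move=> r0 pB tM.
have W (l : 'I_M.+1) : {w | 3 * r * l%:R - r < Num.sqrt (f w) <= 3 * r * l%:R}.
  (* For l = 0 the centre is 0 itself, since the intermediate value argument needs r <= y. *)
  apply: cid; have [l0|l0] := posnP l.
    by exists 0; rewrite l0 f0 sqrtr0 mulr0 lexx andbT; lra.
  have l1 : 1 <= l%:R :> R by rewrite ler1n.
  have lM : l%:R <= M%:R :> R by rewrite ler_nat -ltnS.
  by apply: (@sqrt_level_exists _ _ t); rewrite //; nra.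
pose w l := sval (W l); have wP (l : 'I_M.+1) : 3 * r * l%:R - r < Num.sqrt (f (w l)) <= 3 * r * l%:R by exact: svalP (W l).
have Br b : b \in sublevel (r ^+ 2) -> Num.sqrt (f b) <= r.
  by rewrite inE => h; rewrite -[leRHS](gtr0_norm r0) -sqrtr_sqr ler_wsqrtr.
(* The l-th translate lies in the shell ]3rl - 2r, 3rl + r]. The shells are disjoint, so w l + b
   determines l, and then b. *)
have wb (l : 'I_M.+1) b : b \in sublevel (r ^+ 2) ->
    3 * r * l%:R - 2 * r < Num.sqrt (f (w l + b)) <= 3 * r * l%:R + r.
  move=> /Br hb; have := wP l; have := sqrt_subadd (w l) b.
  by have := sqrt_subadd (w l + b) (- b); rewrite addrK fN; lra.
rewrite -[M.+1 in leqLHS]card_ord -cardsT -cardsX.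
rewrite -(card_in_imset (f := fun x : 'I_M.+1 * F => w x.1 + x.2)); last first.
  move=> [l b] [l' b'] /setXP[_ /= bB] /setXP[_ /= b'B] e.
  have h1 := wb l _ bB; have h2 := wb l' _ b'B; rewrite -e in h2.
  have lt1 : l%:R < l'%:R + 1 :> R by nra.
  have lt2 : l'%:R < l%:R + 1 :> R by nra.
  rewrite natr1 ltr_nat ltnS in lt1; rewrite natr1 ltr_nat ltnS in lt2.
  have ll : l = l' by apply/val_inj/eqP; rewrite eqn_leq lt1.
  by move: e; rewrite ll => /addrI ->.
apply: subset_leq_card; apply/fintype.subsetP => _ /imsetP[[l b] /setXP[_ /= bB] ->].
have := wb l _ bB; rewrite inE => /andP[_ h].
have lM : l%:R <= M%:R :> R by rewrite ler_nat -ltnS.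
have rM : r * l%:R <= r * M%:R by rewrite ler_pM2l.
have rM0 : 0 <= r * M%:R by rewrite mulr_ge0// ltW.
rewrite -natr1 -[leLHS]sqr_sqrtr ?f_ge0// lerXn2r ?nnegrE ?sqrtr_ge0//; lra.
Qed.

Definition dens (x : R) : R := #|sublevel x|%:R / p%:R ^+ 2.

Let p0 : 0 < p%:R :> R.
Proof. by rewrite ltr0n prime_gt0. Qed.

Lemma dens_ge0 x : 0 <= dens x. Proof. by rewrite divr_ge0// sqr_ge0. Qed.

(** A lower sublevel set with at most p elements gives the term 1 / p. Otherwise packing applies
    with about sqrt X / (3 sqrt y) translates, the point [t] ensuring that f climbs high enough; if
    sqrt X < 3 sqrt y, monotonicity suffices. *)
Lemma dens_growth (y X : R) (t : F) : 0 < y -> y <= X -> X <= f t ->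
  dens y <= p%:R^-1 + 6 * (Num.sqrt y / Num.sqrt X) * dens X.
Proof.
move=> y0 yX Xt.
have r0 : 0 < Num.sqrt y by rewrite sqrtr_gt0.
have X0 : 0 < X := lt_le_trans y0 yX.
have s0 : 0 < Num.sqrt X by rewrite sqrtr_gt0.
have dX := dens_ge0 X.
have rX : 0 <= Num.sqrt y / Num.sqrt X by rewrite divr_ge0.
have ip : 0 <= p%:R^-1 :> R by rewrite invr_ge0 ltW.
have mono : dens y <= dens X.
  rewrite ler_wpM2r ?invr_ge0 ?sqr_ge0// ler_nat.
  by apply: subset_leq_card; apply/fintype.subsetP => u; rewrite !inE => /le_trans; apply.
have [small|big] := leqP #|sublevel y| p.
  have : dens y <= p%:R^-1.
    rewrite /dens ler_pdivrMr ?exprn_gt0// expr2 mulrA mulVf ?gt_eqF// mul1r ler_nat//.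
  have : 0 <= 6 * (Num.sqrt y / Num.sqrt X) * dens X by rewrite !mulr_ge0.
  lra.
have [far|near] := leP (3 * Num.sqrt y) (Num.sqrt X); last first.
  have : 1 <= 3 * (Num.sqrt y / Num.sqrt X) by rewrite mulrA ler_pdivlMr; lra.
  nra.
pose z := Num.sqrt X / (3 * Num.sqrt y).
have z1 : 1 <= z by rewrite /z ler_pdivlMr; lra.
have /andP[] := truncn_itv (le_trans ler01 z1).
(* The truncation of z is written [M.+1]: then 3 r M is strictly below sqrt (f t), as [packing]
   requires, and the [M.+1] translates fit under level X. *)
case e : (Num.truncn z) => [|M] Mz zM; first by lra.
have zE : z * (3 * Num.sqrt y) = Num.sqrt X by rewrite /z mulfVK//; lra.
have Mle : 3 * Num.sqrt y * M.+1%:R <= Num.sqrt X by rewrite -zE [leRHS]mulrC ler_pM2l//; lra.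
have key : (M.+1 * #|sublevel y| <= #|sublevel X|)%N.
  have eY : Num.sqrt y ^+ 2 = y by rewrite sqr_sqrtr// ltW.
  have tM : 3 * Num.sqrt y * M%:R < Num.sqrt (f t).
    apply: (@lt_le_trans _ _ (Num.sqrt X)); last by rewrite ler_wsqrtr.
    by apply: lt_le_trans Mle; rewrite ltr_pM2l ?ltr_nat//; lra.
  have := @packing (Num.sqrt y) M t r0; rewrite eY => /(_ big tM) h.
  apply: (leq_trans h); apply: subset_leq_card; apply/fintype.subsetP => u; rewrite !inE => h2.
  apply: (le_trans h2); rewrite -[leRHS](sqr_sqrtr (ltW X0)) lerXn2r ?nnegrE ?sqrtr_ge0//.
have kD : M.+1%:R * dens y <= dens X.
  by rewrite /dens mulrA ler_wpM2r ?invr_ge0 ?sqr_ge0// -natrM ler_nat.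
have zM2 : z <= 2 * M.+1%:R.
  rewrite -natr1 in zM; have : 1 <= M.+1%:R :> R by rewrite ler1n.
  lra.
have dy := dens_ge0 y.
have zinv : Num.sqrt y / Num.sqrt X * z * 3 = 1 by rewrite /z; field; lra.
have : dens y <= 6 * (Num.sqrt y / Num.sqrt X) * dens X.
  have h1 : z * dens y <= 2 * dens X by nra.
  have -> : dens y = 3 * (Num.sqrt y / Num.sqrt X) * (z * dens y).
    by transitivity ((Num.sqrt y / Num.sqrt X * z * 3) * dens y); [rewrite zinv mul1r | ring].
  have := ler_wpM2l rX h1; lra.
lra.
Qed.

Lemma sum_geometric_weighted (q : R) L : 0 <= q < 1 ->
  \sum_(l < L) l.+1%:R * q ^+ l <= (1 - q) ^- 2.
Proof.
move=> /andP[q0 q1].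
have d0 : 0 < (1 - q) ^+ 2 by rewrite exprn_gt0//; lra.
rewrite -[leRHS]div1r ler_pdivlMr//.
have -> : (\sum_(l < L) l.+1%:R * q ^+ l) * (1 - q) ^+ 2
    = 1 - q ^+ L * (1 + L%:R * (1 - q)).
  elim: L => [|L IH]; first by rewrite big_ord0 mul0r expr0 mul0r addr0 mul1r subrr.
  rewrite big_ord_recr/= mulrDl IH [q ^+ L.+1]exprS -[L.+1%:R]natr1; ring.
have : 0 <= q ^+ L * (1 + L%:R * (1 - q)).
  by rewrite mulr_ge0 ?exprn_ge0// addr_ge0// mulr_ge0//; lra.
lra.
Qed.

(** Cut f into unit layers below X. The layer l <= f < l + 1 has weight at most exp (- lam l) and
    density bounded by [dens_growth]; with sqrt (l + 1) <= l + 1 a weighted geometric series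
    remains. Above the integer part of X the exponential itself is small, and rounding costs the
    factor exp lam. *)
Lemma favg_expRN_le (lam X : R) (t : F) : 0 < lam -> 0 < X -> X <= f t ->
  favg p (fun u => expR (- (lam * f u)))
  <= (1 - expR (- lam)) ^- 2 * (p%:R^-1 + 6 / Num.sqrt X * dens X)
     + expR lam * expR (- (lam * X)).
Proof.
move=> l0 X0 Xt.
pose L := Num.truncn X; pose q := expR (- lam).
have /andP[LX XL] := truncn_itv (ltW X0); rewrite -/L in LX XL.
have q01 : 0 <= q < 1 by rewrite expR_ge0 expR_lt1 oppr_lt0.
have pw u : expR (- (lam * f u)) <=
    \sum_(l < L) q ^+ l * (u \in sublevel l.+1%:R)%:R + expR lam * expR (- (lam * X)).
  have s0 (P : pred 'I_L) : 0 <= \sum_(l < L | P l) q ^+ l * (u \in sublevel l.+1%:R)%:R.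
    by apply: sumr_ge0 => l _; rewrite mulr_ge0// exprn_ge0// expR_ge0.
  have [fL|Lf] := ltP (f u) L%:R; last first.
    apply: (@le_trans _ _ (expR lam * expR (- (lam * X)))); last by rewrite lerDr s0.
    rewrite -expRD ler_expR -natr1 in XL *; nra.
  have /andP[l1 l2] := truncn_itv (f_ge0 u).
  have lL : (Num.truncn (f u) < L)%N by rewrite -(ltr_nat R); lra.
  rewrite (bigD1 (Ordinal lL))//= inE (ltW l2) mulr1 -addrA.
  apply: (@le_trans _ _ (q ^+ Num.truncn (f u))).
    rewrite /q -expRM_natr ler_expR; nra.
  by rewrite lerDl addr_ge0// mulr_ge0 ?expR_ge0.
have pp0 : 0 < p%:R ^+ 2 :> R by rewrite exprn_gt0.
have av : favg p (fun u => expR (- (lam * f u))) <=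
    \sum_(l < L) q ^+ l * dens l.+1%:R + expR lam * expR (- (lam * X)).
  rewrite /favg ler_pdivrMr// mulrDl.
  apply: (le_trans (ler_sum _ (fun u _ => pw u))); rewrite big_split/= lerD//; last first.
    by rewrite sumr_const card_prod card_Fp// -[leLHS]mulr_natr natrM -expr2.
  rewrite exchange_big/= mulr_suml; apply: ler_sum => l _.
  rewrite -mulr_sumr -mulrA /dens mulfVK ?gt_eqF// -natr_sum.
  by rewrite -big_mkcond/= sum1_card.
apply: (le_trans av); rewrite lerD2r.
set c := p%:R^-1 + _.
have dX := dens_ge0 X.
have iX : 0 <= (Num.sqrt X)^-1 by rewrite invr_ge0 sqrtr_ge0.
have c0 : 0 <= c.
  by apply: addr_ge0; [rewrite invr_ge0 ltW | apply: mulr_ge0 => //; apply: divr_ge0].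
apply: (@le_trans _ _ ((\sum_(l < L) l.+1%:R * q ^+ l) * c)); last first.
  by rewrite ler_wpM2r// sum_geometric_weighted.
rewrite mulr_suml; apply: ler_sum => l _.
rewrite [l.+1%:R * _]mulrC -mulrA ler_wpM2l ?exprn_ge0 ?expR_ge0//.
have l1 : 1 <= l.+1%:R :> R by rewrite ler1n.
have lX : l.+1%:R <= X by apply: le_trans LX; rewrite ler_nat.
apply: (le_trans (dens_growth _ _ t _ lX Xt)); first lra.
rewrite /c mulrDr; apply: lerD; first by rewrite ler_peMl// invr_ge0 ltW.
have -> : 6 * (Num.sqrt l.+1%:R / Num.sqrt X) * dens X
  = (6 * (Num.sqrt X)^-1 * dens X) * Num.sqrt l.+1%:R by ring.
rewrite [leRHS]mulrC ler_wpM2l//; first by rewrite !mulr_ge0.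
rewrite -[leRHS]ger0_norm; last lra.
by rewrite -sqrtr_sqr ler_wsqrtr//; nra.
Qed.

End Pseudonorm.

(** * Application to sums of cosines *)

Section Halasz.
Context (n : nat).
Local Notation vec := {ffun 'I_n -> F}.

Definition defect (I : {set 'I_n}) (a : vec) (t : F) : R := \sum_(i in I) (1 - ch p t (a i)).

Lemma defect_ge0 (I : {set 'I_n}) (a : vec) t : 0 <= defect I a t.
Proof. by apply: sumr_ge0 => i _; rewrite subr_ge0 ch_le1. Qed.

Lemma favg_defect (I : {set 'I_n}) (a : vec) : (forall i, i \in I -> a i != 0) -> favg p (defect I a) = #|I|%:R.
Proof.
move=> aI.
have pp : p%:R ^+ 2 != 0 :> R by rewrite expf_neq0// pnatr_eq0 -lt0n prime_gt0.
rewrite /favg /defect exchange_big/= mulr_suml.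
rewrite (eq_bigr (fun=> 1)); first by rewrite sumr_const.
move=> i /aI ai; rewrite sumrB sum_ch_dot// (negbTE ai) subr0.
by rewrite sumr_const card_prod card_Fp// natrM -expr2 divff.
Qed.

Lemma halasz (I : {set 'I_n}) (a : vec) (C lam : R) (k : nat) : lam = 1 / (8 * C) ->
  (forall i, i \in I -> a i != 0) -> (0 < #|I|)%N -> 1 <= C -> 32 * C <= k%:R ->
  favg p (fun t => expR (- (lam * defect I a t)))
  <= (1 - expR (- lam)) ^- 2 * (p%:R^-1 + 6 * expR (32 * C) * Num.sqrt (k%:R / #|I|%:R)
        * favg p (fun t => ((\sum_(i in I) ch p t (a i)) / #|I|%:R) ^+ (2 * k)))
     + expR lam * expR (- (#|I|%:R / k%:R)).
Proof.
move=> lamE aI I0 C1 Ck.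
set m := #|I|%:R : R.
have m0 : 0 < m by rewrite ltr0n.
have k0 : 0 < k%:R :> R by lra.
(* This level makes lam X = m / k, and X <= m, which is the mean of the defect; hence some [t]
   reaches it. *)
pose X := 8 * C * m / k%:R.
have X0 : 0 < X by rewrite divr_gt0// mulr_gt0//; lra.
have Xm : X <= m by rewrite ler_pdivrMr//; nra.
have pp0 : 0 < p%:R ^+ 2 :> R by rewrite exprn_gt0// ltr0n prime_gt0.
have [t Xt] : exists t, X <= defect I a t.
  apply: contrapT => no.
  have lt t : defect I a t < X by rewrite ltNge; apply/negP => h; apply: no; exists t.
  have : favg p (defect I a) < X.
    rewrite /favg ltr_pdivrMr//.
    have -> : X * p%:R ^+ 2 = \sum_(t : F) X.
      by rewrite sumr_const card_prod card_Fp// -[RHS]mulr_natr natrM -expr2.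
    by apply: ltr_sum => [|t _ //]; apply/hasP; exists 0; rewrite ?mem_index_enum.
  by rewrite favg_defect// -/m; lra.
have C0 : 0 < 8 * C by lra.
have l0 : 0 < lam by rewrite lamE divr_gt0.
have f0 : defect I a 0 = 0.
  by rewrite /defect big1// => i _; rewrite chC ch0// subrr.
have fN u : defect I a (- u) = defect I a u.
  by apply: eq_bigr => i _; rewrite chC [ch p u _]chC chN.
have fs (e : R) s u : 0 < e ->
    defect I a (s + u) <= (1 + e) * defect I a s + (1 + e^-1) * defect I a u.
  move=> e0; rewrite /defect !mulr_sumr -big_split/=; apply: ler_sum => i _.
  by rewrite chC [ch p s _]chC [ch p u _]chC; exact: ch_subadd.
have H := favg_expRN_le _ (defect_ge0 I a) f0 fN fs lam X t l0 X0 Xt.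
have lX : lam * X = m / k%:R by rewrite lamE /X; field; rewrite !gt_eqF//; lra.
rewrite lX in H; apply: (le_trans H); rewrite lerD2r ler_wpM2l//.
  by rewrite invr_ge0 sqr_ge0.
rewrite lerD2l.
set G := favg p _.
have h0 : forall u, 0 <= ((\sum_(i in I) ch p u (a i)) / m) ^+ (2 * k) :> R.
  by move=> u; rewrite exprM exprn_ge0// sqr_ge0.
(* Markov's inequality: where the defect is at most X, h / m >= 1 - 8 C / k >= exp (- 16 C / k), and
   the 2k-th power of the last term is exp (- 32 C). *)
have dG : dens (defect I a) X <= expR (32 * C) * G.
  have e0 : 0 < expR (- (32 * C)) by exact: expR_gt0.
  have : expR (- (32 * C)) * dens (defect I a) X <= G.
    rewrite /dens mulrA /G /favg ler_wpM2r ?invr_ge0 ?(ltW pp0)//.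
    rewrite mulr_natr -sumr_const.
    rewrite [leRHS](bigID (mem (sublevel (defect I a) X)))/= -[leLHS]addr0.
    apply: lerD; last by apply: sumr_ge0 => u _; exact: h0.
    apply: ler_sum => u; rewrite inE => uX.
    have -> : (\sum_(i in I) ch p u (a i)) / m = 1 - defect I a u / m.
      rewrite /defect sumrB sumr_const -/m; field; by rewrite gt_eqF.
    have y1 : defect I a u / m <= 8 * C / k%:R.
      rewrite ler_pdivrMr// (le_trans uX)// /X le_eqVlt; apply/orP; left; apply/eqP; ring.
    have y2 : 8 * C / k%:R <= 1 / 2 by rewrite ler_pdivrMr//; lra.
    have y0 : 0 <= 8 * C / k%:R by rewrite divr_ge0 ?ltW.
    have ch1 : expR (- (2 * (8 * C / k%:R))) <= 1 - 8 * C / k%:R.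
      by have := @expRN_le_chord R (2 * (8 * C / k%:R)) ltac:(lra); lra.
    have -> : expR (- (32 * C)) = expR (- (2 * (8 * C / k%:R))) ^+ (2 * k).
      by rewrite -expRM_natr natrM; congr expR; field; rewrite gt_eqF.
    rewrite lerXn2r ?nnegrE ?expR_ge0//; lra.
  by rewrite expRN mulrC ler_pdivrMr ?expR_gt0// [leRHS]mulrC.
have sX : (Num.sqrt X)^-1 <= Num.sqrt (k%:R / m).
  have -> : k%:R / m = 8 * C / X by rewrite /X; field; rewrite !gt_eqF//; lra.
  have sq (u v : R) : 0 < u -> 0 < v -> Num.sqrt (u / v) = Num.sqrt u * (Num.sqrt v)^-1.
    by move=> u0 v0; rewrite sqrtrM ?sqrtrV// ltW.
  rewrite sq// ler_peMl ?invr_ge0 ?sqrtr_ge0//.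
  by rewrite -[leLHS]sqrtr1 ler_wsqrtr//; lra.
have d0 := dens_ge0 (defect I a) X.
have i0 : 0 <= (Num.sqrt X)^-1 by rewrite invr_ge0 sqrtr_ge0.
apply: (@le_trans _ _ (6 * Num.sqrt (k%:R / m) * (expR (32 * C) * G))); last first.
  by rewrite le_eqVlt; apply/orP; left; apply/eqP; ring.
by apply: ler_pM => //; rewrite ler_wpM2l.
Qed.
End Halasz.
End Gen.

(** * Comparison with a lazy walk *)

Section PosCos.
Context {R : realType}.

Definition ip (th u : R * R) : R := th.1 * u.1 + th.2 * u.2.

Lemma ipD th u w : ip th (u + w) = ip th u + ip th w.
Proof. by rewrite /ip /= !mulrDr addrACA. Qed.

Lemma ipN th u : ip th (- u) = - ip th u.
Proof. by rewrite /ip /= !mulrN opprD. Qed.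

Lemma ip0 th : ip th 0 = 0.
Proof. by rewrite /ip /= !mulr0 addr0. Qed.

Lemma ip_sum (I : Type) (r : seq I) (P : pred I) (G : I -> R * R) th :
  ip th (\sum_(i <- r | P i) G i) = \sum_(i <- r | P i) ip th (G i).
Proof. exact: (big_morph _ (ipD th) (ip0 th)). Qed.

(** Cosine sums with nonnegative coefficients. In this inductive form, a bound for single cosines
    extends to all of them by induction; closure under products is the product-to-sum formula. *)
Inductive poscos : (R * R -> R) -> Prop :=
| poscos_cos th : poscos (fun u => cos (ip th u))
| poscos_comb w1 w2 f g : 0 <= w1 -> 0 <= w2 -> poscos f -> poscos g ->
    poscos (fun u => w1 * f u + w2 * g u).

Lemma poscosM f g : poscos f -> poscos g -> poscos (fun u => f u * g u).
Proof.
move=> Pf Pg; elim: Pf => [th|w1 w2 f1 f2 w10 w20 _ IH1 _ IH2]; last first.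
  rewrite (_ : (fun u => _) = fun u => w1 * (f1 u * g u) + w2 * (f2 u * g u)).
    exact: poscos_comb.
  by apply/funext => u; ring.
elim: Pg => [th'|w1 w2 f1 f2 w10 w20 _ IH1 _ IH2]; last first.
  rewrite (_ : (fun u => _) =
     fun u => w1 * (cos (ip th u) * f1 u) + w2 * (cos (ip th u) * f2 u)).
    exact: poscos_comb.
  by apply/funext => u; ring.
rewrite (_ : (fun u => _) =
   fun u => 2^-1 * cos (ip (th + th') u) + 2^-1 * cos (ip (th - th') u)).
  by apply: poscos_comb; rewrite ?invr_ge0//; exact: poscos_cos.
apply/funext => u.
have -> : ip (th + th') u = ip th u + ip th' u by rewrite /ip /=; ring.
have -> : ip (th - th') u = ip th u - ip th' u by rewrite /ip /=; ring.
by rewrite cosD cosB; field.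
Qed.

Lemma poscosX f k : poscos f -> poscos (fun u => f u ^+ k).
Proof.
move=> Pf; elim: k => [|k IH].
  rewrite (_ : (fun u => _) = fun u => cos (ip 0 u)); first exact: poscos_cos.
  by apply/funext => u; rewrite /ip /= !mul0r addr0 cos0 expr0.
rewrite (_ : (fun u => _) = fun u => f u * f u ^+ k); first exact: poscosM.
by apply/funext => u; rewrite exprS.
Qed.

Lemma poscos_kern N : poscos (kern N).
Proof.
rewrite (_ : kern N = fun u => (cos (ip ((8 * N%:R)^-1, 0) u) * cos (ip (0, (8 * N%:R)^-1) u)) ^+ (4 * N ^ 2)).
  by apply: poscosX; apply: poscosM; exact: poscos_cos.
by apply/funext => u; rewrite /kern /ip /= !mul0r addr0 add0r ![_^-1 * _]mulrC.
Qed.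
End PosCos.

Section LazyWalk.
Context {R : realType} (lam : R).

(** ['I_3] codes a lazy sign: 0, 1, 2 stand for -1, 0, 1. *)
Definition sg (Y : 'I_3) : int := Y%:Z - 1.
Definition step_law (Y : 'I_3) : R := if val Y == 1%N then 1 - lam else lam / 2.

Lemma lazy_walk_cos n (al : 'I_n -> R) (x : R) :
  \sum_(Y : {ffun 'I_n -> 'I_3}) (\prod_j step_law (Y j)) * cos (\sum_j (sg (Y j))%:~R * al j + x)
  = cos x * \prod_j (1 - lam + lam * cos (al j)).
Proof.
rewrite (sum_prod_cos _ _ (fun _ => step_law) (fun j Y => (sg Y)%:~R * al j)).
have -> : \prod_(j < n) \sum_c (step_law c)%:C%C * expi ((sg c)%:~R * al j)
    = (\prod_j (1 - lam + lam * cos (al j)))%:C%C.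
  rewrite real_complex_prod; apply: eq_bigr => j _.
  rewrite !big_ord_recl big_ord0 /step_law /sg /= addr0.
  rewrite !(mulN1r, mul0r, mul1r) /expi cosN sinN cos0 sin0.
  apply/eqP; rewrite eq_complex/=; apply/andP; split; apply/eqP; field => //.
by rewrite mulrC ReZ mulrC.
Qed.
End LazyWalk.

(** The tangent to exp at the mean lies below the graph. *)
Lemma jensen_expR {R : realType} (I : finType) (w y : I -> R) :
  (forall i, 0 <= w i) -> \sum_i w i = 1 ->
  expR (\sum_i w i * y i) <= \sum_i w i * expR (y i).
Proof.
move=> w0 w1; set m := \sum_i w i * y i.
have -> : expR m = \sum_i w i * (expR m * (1 + (y i - m))).
  rewrite (eq_bigr (fun i => expR m * (w i + w i * y i - w i * m))); last by move=> i _; ring.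
  by rewrite -mulr_sumr sumrB big_split/= -mulr_suml w1 -/m; ring.
apply: ler_sum => i _; rewrite ler_wpM2l//.
have -> : expR (y i) = expR m * expR (y i - m) by rewrite -expRD addrC subrK.
by rewrite ler_wpM2l ?expR_ge0// expR_ge1Dx.
Qed.

(** Telescoping: the two terms at distance i >= 1 from the centre are each at most 2 B (1 / i - 1 /
    (i + 1)). *)
Lemma sum_lattice_le {R : realType} (B : R) (L : nat) : 0 < B ->
  \sum_(i < (2 * L).+1) (1 + (i%:Z - L%:Z)%:~R ^+ 2 / B)^-1 <= 1 + 4 * B.
Proof.
move=> B0; apply: (@le_trans _ _ (1 + 4 * B * (1 - L.+1%:R^-1))); last first.
  by rewrite lerD2l ler_piMr ?mulr_ge0 ?(ltW B0)//.
elim: L => [|L IH].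
  rewrite muln0 big_ord1 /= subrr mulr0z expr0n/= mul0r addr0 invr1 subrr; lra.
have -> : (2 * L.+1).+1 = (2 * L).+3 by lia.
rewrite big_ord_recr big_ord_recl /=.
have l1 : 1 <= L.+1%:R :> R by rewrite ler1n.
have e1 : ((2 * L).+2%:Z - L.+1%:Z)%:~R = L.+1%:R :> R.
  by rewrite (_ : _ - _ = L.+1%:Z)//; lia.
have e0 : (0%:Z - L.+1%:Z)%:~R = - L.+1%:R :> R by rewrite sub0r mulrNz.
rewrite e1 e0 sqrrN.
have -> : \sum_(i < (2 * L).+1) (1 + ((lift ord0 i)%:Z - L.+1%:Z)%:~R ^+ 2 / B)^-1
    = \sum_(i < (2 * L).+1) (1 + (i%:Z - L%:Z)%:~R ^+ 2 / B)^-1.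
  apply: eq_bigr => i _; congr (1 + _%:~R ^+ 2 / B)^-1.
  by rewrite /= /bump /= add1n; lia.
have w : (1 + L.+1%:R ^+ 2 / B)^-1 <= 2 * B * (L.+1%:R^-1 - L.+2%:R^-1).
  have e2 : L.+2%:R = L.+1%:R + 1 :> R by rewrite natr1.
  have -> : 2 * B * (L.+1%:R^-1 - L.+2%:R^-1) = (L.+1%:R * (L.+1%:R + 1) / (2 * B))^-1 :> R.
    by rewrite e2; field; rewrite !gt_eqF//; lra.
  rewrite lef_pV2 ?posrE; last 2 first.
  - by rewrite ltr_pwDl// divr_ge0 ?sqr_ge0// ltW.
  - by rewrite divr_gt0 ?mulr_gt0//; lra.
  rewrite ler_pdivrMr; last lra.
  have : L.+1%:R ^+ 2 / B * (2 * B) = 2 * L.+1%:R ^+ 2 :> R by field; rewrite gt_eqF.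
  nra.
clear l1 e1 e0; move: (\sum_(i < _) _) IH w => S IH.
move: (1 + L.+1%:R ^+ 2 / B)^-1 => W w.
move: L.+1%:R^-1 L.+2%:R^-1 IH w => a b IH w; lra.
Qed.

Lemma ord_shift_exists (L : nat) (g : int) : (`|g| <= L)%N ->
  exists i : 'I_(2 * L).+1, i%:Z - L%:Z = g.
Proof.
move=> gL; have h : (absz (g + L%:Z)%R < (2 * L).+1)%N by lia.
by exists (Ordinal h) => /=; lia.
Qed.

(** * Domination by a dilated lazy walk *)

Section Compare.
Context {R : realType}.

Definition cmul (z : int * int) (u : R * R) : R * R :=
  (z.1%:~R * u.1 - z.2%:~R * u.2, z.1%:~R * u.2 + z.2%:~R * u.1).

Lemma cmulDl z w u : cmul (z + w) u = cmul z u + cmul w u.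
Proof. by rewrite /cmul /= !rmorphD/=; congr (_, _) => /=; ring. Qed.

Lemma cmul0l u : cmul 0 u = 0.
Proof. by rewrite /cmul /= !mul0r subr0 addr0. Qed.

Lemma cmul_suml (I : Type) (r : seq I) (P : pred I) (G : I -> int * int) u :
  cmul (\sum_(i <- r | P i) G i) u = \sum_(i <- r | P i) cmul (G i) u.
Proof. exact: (big_morph (cmul^~ u) (fun z w => cmulDl z w u) (cmul0l u)). Qed.

Lemma cmulBr z u w : cmul z (u - w) = cmul z u - cmul z w.
Proof. by rewrite /cmul /=; congr (_, _) => /=; ring. Qed.

Definition scale (m : int) (z : int * int) : int * int := (m * z.1, m * z.2).

Lemma ip_cmul_scale th m z u : ip th (cmul (scale m z) u) = m%:~R * ip th (cmul z u).
Proof. by rewrite /ip /cmul /= !intrM; ring. Qed.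

Definition nsq (u : R * R) : R := u.1 ^+ 2 + u.2 ^+ 2.

Lemma nsq_cmul z u : nsq (cmul z u) = (z.1%:~R ^+ 2 + z.2%:~R ^+ 2) * nsq u.
Proof. by rewrite /nsq /cmul /=; ring. Qed.

Context (T : finType) (q : T -> R) (pt : T -> R * R) (C : R) (n : nat)
  (v : {ffun 'I_n -> int * int}).
Context (q0 : forall c, 0 <= q c) (q1 : \sum_c q c = 1) (C1 : 1 <= C).

(** The annulus of goodness with 2 C in place of C, which leaves room for the discretisation
    error. *)
Definition good_pair (zz : T * T) : bool :=
  ((2 * C)^-1 ^+ 2 <= nsq (pt zz.1 - pt zz.2)) && (nsq (pt zz.1 - pt zz.2) <= (2 * C) ^+ 2).

Definition pair_mass : R := \sum_(zz | good_pair zz) q zz.1 * q zz.2.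
Context (goodP : (2 * C)^-1 <= pair_mass).

Definition pair_law (zz : T * T) : R :=
  (if good_pair zz then q zz.1 * q zz.2 else 0) / pair_mass.

Let lam := 1 / (8 * C).

Let mass_gt0 : 0 < pair_mass.
Proof. by apply: lt_le_trans goodP; rewrite invr_gt0; move: C1 => ?; lra. Qed.

Lemma pair_law_ge0 zz : 0 <= pair_law zz.
Proof. by rewrite divr_ge0 ?(ltW mass_gt0)//; case: ifP => // _; rewrite mulr_ge0. Qed.

Lemma pair_law_sum : \sum_zz pair_law zz = 1.
Proof. by rewrite -mulr_suml -big_mkcond /= divff// gt_eqF. Qed.

(** The squared modulus of a characteristic function is 1 - u, where u is the mean of 1 - cos of the
    symmetrised angle, and sqrt (1 - u) <= exp (- u / 2). Keeping only good pairs in u costs the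
    factor [pair_mass], which is at least 1 / (2 C). *)
Lemma normc_char_le (al : T -> R) :
  ComplexField.Normc.normc (\sum_c (q c)%:C%C * expi (al c))
  <= expR (\sum_zz pair_law zz * - (1 / (4 * C) * (1 - cos (al zz.1 - al zz.2)))).
Proof.
set u := \sum_(zz : T * T) q zz.1 * q zz.2 * (1 - cos (al zz.1 - al zz.2)).
have nE : ComplexField.Normc.normc (\sum_c (q c)%:C%C * expi (al c)) = Num.sqrt (1 - u).
  rewrite [X in ComplexField.Normc.normc X]complexE.
  have -> (z : R[i]) : ComplexField.Normc.normc ((complex.Re z)%:C%C + 'i%C * (complex.Im z)%:C%C)
     = Num.sqrt (complex.Re z ^+ 2 + complex.Im z ^+ 2) by rewrite -complexE; case: z.
  congr Num.sqrt; rewrite Re_sum Im_sum.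
  rewrite (eq_bigr (fun c => q c * cos (al c))); last by move=> c _; rewrite ReZ.
  rewrite [X in _ + X ^+ 2](eq_bigr (fun c => q c * sin (al c))); last by move=> c _; rewrite ImZ.
  rewrite /u -(pair_bigA _ (fun c c' => q c * q c' * (1 - cos (al c - al c'))))/=.
  have -> : \sum_c \sum_c' q c * q c' * (1 - cos (al c - al c'))
      = 1 - \sum_c \sum_c' q c * q c' * cos (al c - al c').
    transitivity (\sum_c \sum_c' q c * q c' - \sum_c \sum_c' q c * q c' * cos (al c - al c')).
      2: by rewrite -big_distrlr/= q1 mulr1.
    rewrite -sumrB; apply: eq_bigr => c _; rewrite -sumrB; apply: eq_bigr => c' _; ring.
  rewrite opprB [RHS]addrC subrK !expr2 !big_distrlr/= -big_split/=.
  apply: eq_bigr => c _; rewrite -big_split/=; apply: eq_bigr => c' _.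
  by rewrite cosB; ring.
have uge : (2 * C)^-1 * (\sum_zz pair_law zz * (1 - cos (al zz.1 - al zz.2))) <= u.
  apply: (@le_trans _ _ (pair_mass * (\sum_zz pair_law zz * (1 - cos (al zz.1 - al zz.2))))).
    apply: ler_wpM2r goodP; apply: sumr_ge0 => zz _; apply: mulr_ge0; first exact: pair_law_ge0.
    by rewrite subr_ge0 cos_le1.
  rewrite mulr_sumr; apply: ler_sum => zz _.
  rewrite mulrA; apply: ler_wpM2r; first by rewrite subr_ge0 cos_le1.
  rewrite /pair_law mulrC mulfVK ?gt_eqF//.
  by case: ifP => // _; rewrite mulr_ge0.
rewrite nE.
set s := \sum_zz pair_law zz * (1 - cos (al zz.1 - al zz.2)) in uge.
have -> : \sum_zz pair_law zz * - (1 / (4 * C) * (1 - cos (al zz.1 - al zz.2)))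
    = - (1 / (4 * C) * s).
  by rewrite /s mulr_sumr -sumrN; apply: eq_bigr => zz _; ring.
rewrite -[leRHS]ger0_norm ?expR_ge0// -sqrtr_sqr ler_wsqrtr//.
rewrite -expRM_natr; apply: (le_trans (expR_ge1Dx (- u))); rewrite ler_expR.
have -> : - (1 / (4 * C) * s) * 2 = - ((2 * C)^-1 * s) by move: C1 => ?; field; lra.
by rewrite lerN2.
Qed.

Definition walk (Y : {ffun 'I_n -> 'I_3}) : int * int := \sum_j scale (sg (Y j)) (v j).
Definition walk_law (Y : {ffun 'I_n -> 'I_3}) : R := \prod_j step_law lam (Y j).

Let lam_bounds : 0 < lam <= 1 / 8.
Proof.
move: C1 => ?.
by rewrite /lam; apply/andP; split; [apply: divr_gt0; lra | rewrite ler_pdivrMr; lra].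
Qed.

Lemma walk_law_ge0 Y : 0 <= walk_law Y.
Proof.
apply: prodr_ge0 => j _; rewrite /step_law; have /andP[? ?] := lam_bounds.
by case: ifP => _; lra.
Qed.

(** Jensen pulls the average over pairs out of the product of exponentials, so that one pair [zz]
    serves all coordinates. In each coordinate there remains exp (- 2 lam (1 - cos)) <= 1 - lam +
    lam cos, the characteristic function of a lazy sign. *)
Lemma avg_cos_le (th x : R * R) :
  \sum_(c : {ffun 'I_n -> T}) (\prod_j q (c j)) * cos (ip th (\sum_j cmul (v j) (pt (c j)) - x))
  <= \sum_zz pair_law zz * \sum_Y walk_law Y * cos (ip th (cmul (walk Y) (pt zz.1 - pt zz.2))).
Proof.
pose al j c := ip th (cmul (v j) (pt c)).
rewrite (eq_bigr (fun c : {ffun 'I_n -> T} =>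
   (\prod_j q (c j)) * cos (\sum_j al j (c j) + (- ip th x)))); last first.
  by move=> c _; rewrite ipD ipN ip_sum.
rewrite (sum_prod_cos n T (fun _ => q) al).
apply: (le_trans (Re_le_normc _)).
rewrite ComplexField.Normc.normcM normc_expi mul1r normc_prod.
apply: (@le_trans _ _ (\prod_(j < n) expR (\sum_zz pair_law zz *
     - (1 / (4 * C) * (1 - cos (al j zz.1 - al j zz.2)))))).
  apply: ler_prod => j _; rewrite normc_char_le andbT.
  by case: (\sum_c _) => a b /=; exact: sqrtr_ge0.
rewrite -expR_sum exchange_big/=.
rewrite (eq_bigr (fun zz => pair_law zz *
    \sum_j - (1 / (4 * C) * (1 - cos (al j zz.1 - al j zz.2))))); last first.
  by move=> zz _; rewrite mulr_sumr.
apply: (le_trans (jensen_expR _ _ _ pair_law_ge0 pair_law_sum)).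
apply: ler_sum => zz _; rewrite ler_wpM2l ?pair_law_ge0//.
rewrite (eq_bigr (fun Y => walk_law Y *
   cos (\sum_j (sg (Y j))%:~R * (al j zz.1 - al j zz.2) + 0))); last first.
  move=> Y _; rewrite addr0 cmul_suml ip_sum; congr (_ * cos _).
  by apply: eq_bigr => j _; rewrite ip_cmul_scale cmulBr ipD ipN.
rewrite lazy_walk_cos cos0 [leRHS]mul1r expR_sum; apply: ler_prod => j _; rewrite expR_ge0/=.
set w := cos _.
have w1 : w <= 1 := cos_le1 _. have w2 : -1 <= w := cos_geN1 _.
have /andP[l0 l1] := lam_bounds.
have e4 : 1 / (4 * C) = 2 * lam by move: C1 => ?; rewrite /lam; field; lra.
rewrite e4; have := @expRN_le_chord R (2 * lam * (1 - w)) ltac:(apply/andP; split; nra).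
lra.
Qed.

Lemma avg_poscos_le K (x : R * R) : poscos K ->
  \sum_(c : {ffun 'I_n -> T}) (\prod_j q (c j)) * K (\sum_j cmul (v j) (pt (c j)) - x)
  <= \sum_zz pair_law zz * \sum_Y walk_law Y * K (cmul (walk Y) (pt zz.1 - pt zz.2)).
Proof.
elim=> [th|w1 w2 f g w10 w20 _ IHf _ IHg]; first exact: avg_cos_le.
have lin (I : finType) (W F G : I -> R) :
    \sum_i W i * (w1 * F i + w2 * G i) = w1 * (\sum_i W i * F i) + w2 * (\sum_i W i * G i).
  by rewrite !mulr_sumr -big_split/=; apply: eq_bigr => i _; ring.
rewrite lin.
rewrite [leRHS](eq_bigr (fun zz => pair_law zz *
    (w1 * (\sum_Y walk_law Y * f (cmul (walk Y) (pt zz.1 - pt zz.2)))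
    + w2 * (\sum_Y walk_law Y * g (cmul (walk Y) (pt zz.1 - pt zz.2)))))); last first.
  by move=> zz _; rewrite lin.
by rewrite lin lerD// ler_wpM2l.
Qed.

End Compare.

(** * The return probability modulo p *)

Section Reduction.
Context {R : realType} (p : nat) (p_pr : prime p).
Local Notation F := ('F_p * 'F_p)%type.

Definition red (z : int * int) : F := (z.1%:~R, z.2%:~R).

Lemma redD z w : red (z + w) = red z + red w.
Proof. by rewrite /red /= !rmorphD. Qed.

Lemma red0 : red 0 = 0.
Proof. by []. Qed.

Lemma red_sum (I : Type) (r : seq I) (P : pred I) (G : I -> int * int) :
  red (\sum_(i <- r | P i) G i) = \sum_(i <- r | P i) red (G i).
Proof. exact: (big_morph _ redD red0). Qed.

Lemma dot_red_scale t (m : int) z : dot p t (red (scale m z)) = m%:~R * dot p t (red z).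
Proof. by rewrite /dot /red /scale /= !intrM; ring. Qed.

Lemma ep_intmul (m : int) (x : 'F_p) :
  ep p (m%:~R * x) = expi (m%:~R * (2 * pi * (x : nat)%:R / p%:R)) :> R[i].
Proof.
have nat_case (k : nat) : ep p (k%:R * x) = expi (k%:R * (2 * pi * (x : nat)%:R / p%:R)) :> R[i].
  elim: k => [|k IH]; first by rewrite !mul0r ep0// expi0.
  rewrite -[k.+1%:R in LHS]natr1 -[k.+1%:R in RHS]natr1 [in LHS]mulrDl mul1r epD// IH.
  by rewrite [(k%:R + 1) * _]mulrDl mul1r expiD.
case: m => k; first exact: nat_case.
have inv (y : 'F_p) (s : R) : ep p y = expi s -> ep p (- y) = expi (- s).
  move=> h; have e1 := epN p p_pr y (R := R); rewrite h in e1.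
  have e2 : expi s * expi (- s) = 1 by rewrite -expiD subrr expi0.
  by rewrite -[LHS]mulr1 -e2 mulrA e1 mul1r.
by rewrite NegzE !mulrNz !mulNr; apply: inv; exact: nat_case.
Qed.

Section Walk.
Context (C : R) (n : nat) (v : {ffun 'I_n -> int * int}) (C1 : 1 <= C).
Let lam := 1 / (8 * C).
Let a := phi_p p n v.

(** By orthogonality, the probability that the lazy walk with steps [v] is 0 modulo p. *)
Definition walk_return : R := favg p (fun t => \prod_j (1 - lam + lam * ch p t (a j))).

Let lam_bounds : 0 < lam <= 1 / 8.
Proof.
move: C1 => ?.
by rewrite /lam; apply/andP; split; [apply: divr_gt0; lra | rewrite ler_pdivrMr; lra].
Qed.

(** Being at [g] forces being at [g] modulo p. The Fourier factors are nonnegative because lam <= 1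
    / 8, so dropping the phase of [g] can only increase the sum. *)
Lemma walk_hit_le (g : int * int) :
  \sum_Y walk_law C n Y * (walk n v Y == g)%:R <= walk_return.
Proof.
have pp0 : 0 < p%:R ^+ 2 :> R by rewrite exprn_gt0// ltr0n prime_gt0.
have chE t Y : ch p t (red (walk n v Y) - red g) =
    cos (\sum_j (sg (Y j))%:~R * (2 * pi * (dot p t (a j) : nat)%:R / p%:R)
       + - (2 * pi * (dot p t (red g) : nat)%:R / p%:R)) :> R.
  rewrite /ch dotDr dotNr epD// /walk red_sum dot_sumr ep_sum//.
  rewrite (eq_bigr (fun j => expi ((sg (Y j))%:~R * (2 * pi * (dot p t (a j) : nat)%:R / p%:R)))).
    rewrite -expi_sum -mulN1r -[-1]/((-1)%:~R) ep_intmul -expiD.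
    by rewrite mulrN1z mulN1r.
  by move=> j _; rewrite dot_red_scale ep_intmul /a /phi_p ffunE.
apply: (@le_trans _ _ (\sum_Y walk_law C n Y * favg p (fun t => ch p t (red (walk n v Y) - red g)))).
  apply: ler_sum => Y _; rewrite ler_wpM2l ?walk_law_ge0// favg_ch//.
  by case: eqP => [->|_]; rewrite ?subrr ?eqxx// ler0n.
rewrite /walk_return /favg.
rewrite (eq_bigr (fun Y => (\sum_t walk_law C n Y * ch p t (red (walk n v Y) - red g)) / p%:R ^+ 2)).
  2: by move=> Y _; rewrite mulrA mulr_sumr.
rewrite -mulr_suml exchange_big/= ler_wpM2r ?invr_ge0 ?(ltW pp0)//.
apply: ler_sum => t _.
under eq_bigr => Y _ do rewrite chE.
rewrite lazy_walk_cos.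
have p0 : 0 <= \prod_(j < n) (1 - lam + lam * ch p t (a j)).
  apply: prodr_ge0 => j _; have /andP[l0 l1] := lam_bounds.
  have := ch_norm_le1 p t (a j) (R := R); rewrite ler_norml => /andP[c1 c2]; nra.
by rewrite -[leRHS]mul1r ler_wpM2r// cos_le1.
Qed.

Context (T : finType) (q : T -> R) (pt : T -> R * R)
  (q0 : forall c, 0 <= q c) (q1 : \sum_c q c = 1)
  (goodP : (2 * C)^-1 <= pair_mass T q pt C).

(** The kernel is at least 1/2 on the disc of radius 2, whence the factor 2. After passing to the
    dilated walk, the kernel is bounded by a product of two summable weights in the coordinates of
    the position g, and each g has probability at most [walk_return]. *)
Lemma small_ball_le_walk_return (x : R * R) :
  \sum_(c : {ffun 'I_n -> T} | nsq (\sum_j cmul (v j) (pt (c j)) - x) <= 4) \prod_j q (c j)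
  <= 2 * (1 + 4 * (256 * C ^+ 2)) ^+ 2 * walk_return.
Proof.
have C0 : 0 < C := lt_le_trans ltr01 C1.
(* 256 C^2 = 64 (2 C)^2: the 64 of [kern_le] and the lower bound |u|^2 >= (2 C)^-2. *)
set B := 256 * C ^+ 2.
have B0 : 0 < B by apply: mulr_gt0; [exact: ltr0n | exact: exprn_gt0].
(* [L] bounds the coordinates of the walk; [N] below then keeps every argument of the kernel within
   the range of [kern_le], away from the other periods. *)
pose L := (\sum_j (`|(v j).1| + `|(v j).2|))%N.
have walkL Y : (`|(walk n v Y).1| <= L)%N /\ (`|(walk n v Y).2| <= L)%N.
  have sgle (i : 'I_3) : (`|sg i| <= 1)%N by case: i => [[|[|[|]]]].
  rewrite /walk /L; elim/big_ind2: _ => //=.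
    by move=> [x1 z1] y1 [x2 z2] y2 /= [h1 h2] [h3 h4]; split; lia.
  move=> j _; rewrite !abszM; have := sgle (Y j); split.
    by apply: (@leq_trans (1 * `|(v j).1|)); [rewrite leq_mul2r sgle orbT | lia].
  by apply: (@leq_trans (1 * `|(v j).2|)); [rewrite leq_mul2r sgle orbT | lia].
pose N := (Num.truncn (C * L%:R)).+1.
have NP : C * L%:R <= N%:R.
  have /andP[_ h] := truncn_itv (mulr_ge0 (le_trans ler01 C1) (ler0n R L)).
  exact: ltW h.
have N0 : 0 <= N%:R :> R by [].
pose w (i : int) : R := (1 + i%:~R ^+ 2 / B)^-1.
have kle Y zz : good_pair T pt C zz ->
    kern N (cmul (walk n v Y) (pt zz.1 - pt zz.2)) <= w (walk n v Y).1 * w (walk n v Y).2.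
  move=> /andP[]; move: (pt zz.1 - pt zz.2) => u lo hi.
  have [] := walkL Y; move: (walk n v Y) => g g1 g2; clear Y walkL.
  have C2 : 0 <= 2 * C by rewrite mulr_ge0// ltW.
  have ub (s : R) : s ^+ 2 <= nsq u -> `|s| <= 2 * C.
    move=> h; rewrite -(@ler_pXn2r _ 2)// ?nnegrE// real_normK ?num_real//.
    exact: le_trans h hi.
  have u1 : `|u.1| <= 2 * C by apply: ub; rewrite /nsq lerDl sqr_ge0.
  have u2 : `|u.2| <= 2 * C by apply: ub; rewrite /nsq lerDr sqr_ge0.
  have gL (i : int) : (`|i| <= L)%N -> `|i%:~R| <= L%:R :> R.
    by move=> h; rewrite -intr_norm -abszE -pmulrn ler_nat.
  have pr (i : int) (s : R) : (`|i| <= L)%N -> `|s| <= 2 * C -> `|i%:~R * s| <= 2 * (C * L%:R).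
    move=> /gL hi' hs; rewrite normrM.
    by have := ler_pM (normr_ge0 _) (normr_ge0 _) hi' hs; lra.
  have h1 : `|(cmul g u).1| <= 8 * N%:R.
    rewrite /cmul /=; apply: (le_trans (ler_normB _ _)).
    by have := pr _ _ g1 u1; have := pr _ _ g2 u2; lra.
  have h2 : `|(cmul g u).2| <= 8 * N%:R.
    rewrite /cmul /=; apply: (le_trans (ler_normD _ _)).
    by have := pr _ _ g1 u2; have := pr _ _ g2 u1; lra.
  have := kern_le N _ (ltn0Sn _) h1 h2.
  have -> : (cmul g u).1 ^+ 2 + (cmul g u).2 ^+ 2
     = (g.1%:~R ^+ 2 + g.2%:~R ^+ 2) * nsq u by exact: nsq_cmul.
  set A1 : R := g.1%:~R ^+ 2; set A2 : R := g.2%:~R ^+ 2 => kl.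
  have A10 : 0 <= A1 by exact: sqr_ge0.
  have A20 : 0 <= A2 by exact: sqr_ge0.
  have low : (A1 + A2) / B <= (A1 + A2) * nsq u / 64.
    have -> : (A1 + A2) / B = (A1 + A2) * (2 * C)^-1 ^+ 2 / 64 by rewrite /B; field; lra.
    by rewrite ler_wpM2r// ler_wpM2l// addr_ge0.
  have d1 : 0 <= A1 / B by rewrite divr_ge0// ltW.
  have d2 : 0 <= A2 / B by rewrite divr_ge0// ltW.
  rewrite /w -/A1 -/A2 -invfM -[leRHS]div1r ler_pdivlMr; last by rewrite mulr_gt0//; lra.
  apply: le_trans kl; rewrite ler_wpM2l ?kern_ge0//.
  rewrite mulrDl in low.
  apply: (@le_trans _ _ ((1 + (A1 / B + A2 / B)) ^+ 2)); first by nra.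
  by rewrite lerXn2r ?nnegrE//; lra.
apply: (@le_trans _ _ (2 * \sum_(c : {ffun 'I_n -> T}) (\prod_j q (c j)) * kern N (\sum_j cmul (v j) (pt (c j)) - x))).
  rewrite mulr_sumr [leRHS](bigID (fun c : {ffun 'I_n -> T} => nsq (\sum_j cmul (v j) (pt (c j)) - x) <= 4))/=.
  rewrite -[leLHS]addr0 lerD//; last first.
    apply: sumr_ge0 => c _; rewrite mulr_ge0// mulr_ge0 ?kern_ge0//.
    by apply: prodr_ge0.
  apply: ler_sum => c hc; set u := _ - x in hc *.
  have ub (s : R) : s ^+ 2 <= nsq u -> `|s| <= 2.
    move=> h; rewrite -(@ler_pXn2r _ 2)// ?nnegrE// real_normK ?num_real//.
    by apply: (le_trans h); lra.
  have k1 : 1 / 2 <= kern N u.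
    by apply: kern_ge_half => //; apply: ub; rewrite /nsq ?lerDl ?lerDr sqr_ge0.
  have P0 : 0 <= \prod_j q (c j) by apply: prodr_ge0.
  nra.
rewrite -mulrA ler_wpM2l//.
apply: (le_trans (avg_poscos_le _ _ _ _ _ _ q0 q1 C1 goodP _ x (poscos_kern N))).
have lw zz : 0 <= pair_law T q pt C zz by apply: pair_law_ge0.
apply: (@le_trans _ _ (\sum_zz pair_law T q pt C zz * ((1 + 4 * B) ^+ 2 * walk_return))); last first.
  by rewrite -mulr_suml (pair_law_sum T q pt C C1 goodP) mul1r.
apply: ler_sum => zz _.
have [gz|bz] := boolP (good_pair T pt C zz); last first.
  by rewrite /pair_law (negbTE bz) !mul0r.
rewrite ler_wpM2l//.
apply: (@le_trans _ _ (\sum_Y walk_law C n Y * (w (walk n v Y).1 * w (walk n v Y).2))).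
  by apply: ler_sum => Y _; rewrite ler_wpM2l ?walk_law_ge0// kle.
pose I := 'I_(2 * L).+1.
pose off (i : I) : int := i%:Z - L%:Z.
have w0 i : 0 <= w i by rewrite invr_ge0 addr_ge0// divr_ge0 ?sqr_ge0// ltW.
apply: (@le_trans _ _ (\sum_(ij : I * I) (w (off ij.1) * w (off ij.2))
     * \sum_Y walk_law C n Y * (walk n v Y == (off ij.1, off ij.2))%:R)).
  under [leRHS]eq_bigr do rewrite mulr_sumr.
  rewrite exchange_big/=; apply: ler_sum => Y _.
  have [g1 g2] := walkL Y.
  have [i1 i1E] := ord_shift_exists L _ g1; have [i2 i2E] := ord_shift_exists L _ g2.
  rewrite (bigD1 (i1, i2))//= /off i1E i2E -surjective_pairing eqxx mulr1.
  rewrite [leRHS]addrC mulrC ler_wpDl//.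
  apply: sumr_ge0 => ij _; rewrite !mulr_ge0 ?walk_law_ge0//.
apply: (@le_trans _ _ (\sum_(ij : I * I) (w (off ij.1) * w (off ij.2)) * walk_return)).
  by apply: ler_sum => ij _; rewrite ler_wpM2l ?mulr_ge0// walk_hit_le.
have wr0 : 0 <= walk_return.
  apply: le_trans (walk_hit_le 0); apply: sumr_ge0 => Y _.
  by rewrite mulr_ge0 ?walk_law_ge0.
rewrite -mulr_suml ler_wpM2r//.
rewrite -(pair_bigA _ (fun i j : I => w (off i) * w (off j)))/= -big_distrlr/= -expr2.
rewrite lerXn2r ?nnegrE ?sumr_ge0//; first by lra.
exact: sum_lattice_le.
Qed.
End Walk.
End Reduction.

(** * Discretisation *)

Section Discretize.
Context {R : realType} {d : measure_display} {Omega : measurableType d}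
  (P : probability Omega R).

Definition pr (A : set Omega) : R := fine (P A).

Lemma prE A : measurable A -> P A = (pr A)%:E.
Proof. by move=> mA; rewrite /pr fineK// fin_num_measure. Qed.

Lemma pr_ge0 A : 0 <= pr A.
Proof. exact/fine_ge0/measure_ge0. Qed.

Lemma pr_cover (I : finType) (G : pred I) (A : set Omega) (E : I -> set Omega) :
  measurable A -> (forall i, measurable (E i)) ->
  A `<=` [set w | exists2 i, G i & E i w] -> pr A <= \sum_(i | G i) pr (E i).
Proof.
move=> mA mE AE.
pose E' i := if G i then E i else set0.
have mE' i : measurable (E' i) by rewrite /E'; case: ifP.
have : A `<=` \bigcup_(i in [set` predT]) E' i -> (P A <= \sum_(i \in [set` predT]) P (E' i))%E :=
  @content_sub_fsum _ _ _ P I [set` predT] A E' finite_finset (fun i _ => mE' i) mA.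
rewrite -(bigfs _ (index_enum_uniq I)); last by move=> i _; rewrite mem_index_enum.
rewrite prE// (eq_bigr (fun i => (if G i then pr (E i) else 0)%:E)).
  rewrite sumEFin lee_fin -big_mkcond; apply => w /AE[i Gi Eiw].
  by exists i => //; rewrite /E' Gi.
by move=> i _; rewrite /E'; case: ifP => _; [rewrite prE | rewrite measure0].
Qed.

Lemma pr_partition (I : finType) (E : I -> set Omega) : (forall i, measurable (E i)) ->
  trivIset setT E -> (forall w, exists i, E i w) -> \sum_i pr (E i) = 1.
Proof.
move=> mE tE cE.
have : (P (\bigcup_(i in [set` predT]) E i) = \sum_(i \in [set` predT]) P (E i))%E :=
  @measure_fin_bigcup _ _ _ P I [set` predT] E finite_finset (sub_trivIset (@subsetT _ _) tE) (fun i _ => mE i).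
have -> : \bigcup_(i in [set` predT]) E i = setT.
  by apply/seteqP; split => // w _; have [i Ei] := cE w; exists i.
rewrite probability_setT -(bigfs _ (index_enum_uniq I)); last by move=> i _; rewrite mem_index_enum.
rewrite (eq_bigr (fun i => (pr (E i))%:E)) => [|i _]; last by rewrite prE.
by rewrite sumEFin => -[].
Qed.

(** One parameter governs both the mesh 1 / K and the box [-K, K[^2. [None] stands for the outside
    of the box; its point is a dummy, as this cell will have small mass. *)
Definition grid_pt (K : nat) (c : option ('I_(2 * K * K) * 'I_(2 * K * K))) : R * R :=
  if c is Some (i, j) then (i%:R / K%:R - K%:R, j%:R / K%:R - K%:R) else (0, 0).

Definition grid_itv (K : nat) (i : nat) : set R :=
  [set` `[i%:R / K%:R - K%:R, i.+1%:R / K%:R - K%:R[ ].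

Definition grid_box (K : nat) : set (R * R) :=
  [set` `[- K%:R, K%:R[ ] `*` [set` `[- K%:R, K%:R[ ].

Definition grid_cell (K : nat) (c : option ('I_(2 * K * K) * 'I_(2 * K * K))) : set (R * R) :=
  if c is Some (i, j) then grid_itv K i `*` grid_itv K j else ~` grid_box K.

Lemma measurable_grid_cell K c : measurable (grid_cell K c).
Proof.
case: c => [[i j]|] /=; first by apply: measurableX; exact: measurable_itv.
by apply: measurableC; apply: measurableX; exact: measurable_itv.
Qed.

Lemma grid_itv_exists K x : (0 < K)%N -> - K%:R <= x < K%:R ->
  exists i : 'I_(2 * K * K), grid_itv K i x.
Proof.
move=> K0 /andP[x1 x2]; have K1 : 0 < K%:R :> R by rewrite ltr0n.
have y0 : 0 <= (x + K%:R) * K%:R by rewrite mulr_ge0//; lra.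
have /andP[h1 h2] := truncn_itv y0; set i := Num.truncn _ in h1 h2.
have iK : (i < 2 * K * K)%N.
  rewrite -(ltr_nat R) !natrM; apply: (le_lt_trans h1).
  by rewrite ltr_pM2r//; lra.
exists (Ordinal iK); rewrite /grid_itv /= in_itv/=; apply/andP; split.
  by rewrite lerBlDr ler_pdivrMr.
by rewrite ltrBrDr ltr_pdivlMr.
Qed.

Lemma grid_itv_box K x (i : 'I_(2 * K * K)) : grid_itv K i x -> - K%:R <= x < K%:R.
Proof.
have K0 : (0 < K)%N by case: K i => // -[].
have K1 : 0 < K%:R :> R by rewrite ltr0n.
rewrite /grid_itv /= in_itv/= => /andP[h1 h2].
have i0 : 0 <= i%:R / K%:R :> R by rewrite divr_ge0.
have i1 : i.+1%:R / K%:R <= 2 * K%:R :> R.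
  by rewrite ler_pdivrMr// -!natrM ler_nat.
by apply/andP; split; lra.
Qed.

Lemma grid_itv_inj K x i j : (0 < K)%N -> grid_itv K i x -> grid_itv K j x -> i = j.
Proof.
move=> K0; have K1 : 0 < K%:R :> R by rewrite ltr0n.
have h a b : grid_itv K a x -> grid_itv K b x -> (a <= b)%N.
  rewrite /grid_itv /= !in_itv/= => /andP[h1 _] /andP[_ h2].
  have : a%:R / K%:R < b.+1%:R / K%:R :> R by lra.
  by rewrite ltr_pM2r ?invr_gt0// ltr_nat ltnS.
by move=> hi hj; apply/eqP; rewrite eqn_leq !h.
Qed.

Lemma grid_cell_exists K u : (0 < K)%N -> exists c, grid_cell K c u.
Proof.
move=> K0; have [[b1 b2]|nb] := pselect (grid_box K u); last by exists None.
rewrite /= !in_itv/= in b1 b2.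
have [i hi] := grid_itv_exists K _ K0 b1; have [j hj] := grid_itv_exists K _ K0 b2.
by exists (Some (i, j)).
Qed.

Lemma grid_cell_inj K u c c' : (0 < K)%N -> grid_cell K c u -> grid_cell K c' u -> c = c'.
Proof.
move=> K0; case: c c' => [[i j]|] [[i' j']|] //=.
- move=> [h1 h2] [h3 h4]; congr (Some (_, _)); apply/val_inj.
    exact: grid_itv_inj h1 h3.
  exact: grid_itv_inj h2 h4.
- by move=> [h1 h2]; case; split; rewrite /= in_itv/=; [exact: grid_itv_box h1|exact: grid_itv_box h2].
- by move=> nb [h1 h2]; case: nb; split; rewrite /= in_itv/=; [exact: grid_itv_box h1|exact: grid_itv_box h2].
Qed.

Lemma grid_cell_close K u i j : (0 < K)%N -> grid_cell K (Some (i, j)) u ->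
  `|(grid_pt K (Some (i, j))).1 - u.1| <= K%:R^-1 /\ `|(grid_pt K (Some (i, j))).2 - u.2| <= K%:R^-1.
Proof.
move=> K0 [] /=; have K1 : 0 < K%:R :> R by rewrite ltr0n.
have iK : 0 <= K%:R^-1 :> R by rewrite invr_ge0.
rewrite /grid_itv /= !in_itv/= -![_.+1%:R]natr1 !mulrDl !mul1r => /andP[h1 h2] /andP[h3 h4].
by split; rewrite ler_norml; apply/andP; split; lra.
Qed.

(** Continuity from below along the boxes, which exhaust the plane. *)
Lemma grid_box_mass (X : Omega -> R * R) (e : R) : measurable_fun setT X -> 0 < e ->
  exists K0 : nat, forall K, (K0 <= K)%N -> pr (X @^-1` (~` grid_box K)) <= e.
Proof.
move=> mX e0.
pose F (K : nat) := X @^-1` grid_box K.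
have mbox K : measurable (grid_box K) by apply: measurableX; exact: measurable_itv.
have mF K : measurable (F K) by rewrite -[F K]setTI; apply: mX.
have ndF : nondecreasing_seq F.
  move=> a b ab; apply/subsetPset => w [] /=; rewrite !in_itv/= => h1 h2.
  have abR : a%:R <= b%:R :> R by rewrite ler_nat.
  by split; rewrite /= in_itv/=; lra.
have FT : \bigcup_n F n = setT.
  apply/seteqP; split => // w _.
  exists (Num.truncn (`|(X w).1| + `|(X w).2|)).+1 => //.
  have /andP[_ h] := truncn_itv (addr_ge0 (normr_ge0 (X w).1) (normr_ge0 (X w).2)).
  set k := (Num.truncn _).+1 in h *.
  have n1 := normr_ge0 (X w).1; have n2 := normr_ge0 (X w).2.
  have b1 : `|(X w).1| < k%:R by lra.
  have b2 : `|(X w).2| < k%:R by lra.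
  move: b1 b2; rewrite !ltr_norml => /andP[? ?] /andP[? ?].
  by split; rewrite /= in_itv/=; lra.
have cv : (P \o F) k @[k --> \oo] --> (1 : \bar R)%E.
  rewrite -(@probability_setT _ _ _ P) -FT.
  by apply: nondecreasing_cvg_mu => //; apply: bigcup_measurable => k _; exact: mF.
have e1 : 1 - e < 1 by lra.
have [K0 _ hK] := @cvgr_gt R nat \oo _ _ _ (fine_cvg cv) _ e1.
exists K0 => K KK0; have := hK K KK0; rewrite /= -/(pr (F K)) => h.
have mc : measurable (X @^-1` (~` grid_box K)).
  by rewrite -preimage_setC; apply: measurableC; exact: mF.
have : P (X @^-1` (~` grid_box K)) = (1 - P (F K))%E.
  by rewrite -preimage_setC; exact: probability_setC (mF K).
rewrite (prE _ mc) (prE _ (mF K)) -EFinB => -[->]; lra.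
Qed.

End Discretize.

Section ComplexPairs.
Context {R : realType}.

Definition cp (z : R[i]) : R * R := (complex.Re z, complex.Im z).

Lemma cpD z w : cp (z + w) = cp z + cp w.
Proof. by case: z w => [a b] [c e]. Qed.

Lemma cpB z w : cp (z - w) = cp z - cp w.
Proof. by case: z w => [a b] [c e]. Qed.

Lemma cp_gaussM g z : cp (gauss g * z) = cmul g (cp z).
Proof. by case: z => a b; rewrite /cp /cmul /gauss /=. Qed.

Lemma cp_sum (I : Type) (r : seq I) (Q : pred I) (G : I -> R[i]) :
  cp (\sum_(i <- r | Q i) G i) = \sum_(i <- r | Q i) cp (G i).
Proof. exact: (big_morph cp cpD (erefl : cp 0 = 0)). Qed.

Lemma nsq_ge0 (u : R * R) : 0 <= nsq u.
Proof. by rewrite addr_ge0 ?sqr_ge0. Qed.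

Lemma cnorm_le (z : R[i]) (r : R) : 0 <= r -> (cnorm z <= r) = (nsq (cp z) <= r ^+ 2).
Proof.
move=> r0; rewrite -(@ler_pXn2r _ 2)// ?nnegrE ?sqrtr_ge0//.
by rewrite sqr_sqrtr// (nsq_ge0 (cp z)).
Qed.

Lemma cnorm_ge (z : R[i]) (r : R) : 0 <= r -> (r <= cnorm z) = (r ^+ 2 <= nsq (cp z)).
Proof.
move=> r0; rewrite -(@ler_pXn2r _ 2)// ?nnegrE ?sqrtr_ge0//.
by rewrite sqr_sqrtr// (nsq_ge0 (cp z)).
Qed.

Lemma nsqD_le (u w : R * R) : nsq (u + w) <= 2 * nsq u + 2 * nsq w.
Proof.
rewrite /nsq /=; have := sqr_ge0 (u.1 - w.1); have := sqr_ge0 (u.2 - w.2); nra.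
Qed.

Lemma nsq_le_half (u : R * R) : `|u.1| <= 1 / 2 -> `|u.2| <= 1 / 2 -> nsq u <= 1 / 2.
Proof.
have sq (s : R) : `|s| <= 1 / 2 -> s ^+ 2 <= 1 / 4.
  by move=> h; rewrite -real_normK ?num_real//; have := normr_ge0 s; nra.
by move=> /sq h1 /sq h2; rewrite /nsq; lra.
Qed.

Lemma sqrB_le (e s t : R) : `|s| <= e -> `|t| <= e -> (s - t) ^+ 2 <= (2 * e) ^+ 2.
Proof.
move=> hs ht; rewrite -(real_normK (num_real (s - t))).
rewrite lerXn2r ?nnegrE//; first by have := normr_ge0 s; lra.
by apply: (le_trans (ler_normB _ _)); lra.
Qed.

(** [nsqD_le] serves twice: for u + b from above, and for u = (u + b) - b from below, where |u|^2 /
    2 - |b|^2 is at least 3 / (8 C^2). *)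
Lemma nsq_annulus_perturb (C : R) (u b : R * R) : 1 <= C ->
  C^-1 ^+ 2 <= nsq u <= C ^+ 2 -> nsq b <= 2 * (4 * C)^-1 ^+ 2 ->
  (2 * C)^-1 ^+ 2 <= nsq (u + b) <= (2 * C) ^+ 2.
Proof.
move=> C1 /andP[lo hi] bs.
have nb : nsq (- b) = nsq b by rewrite /nsq /= !sqrrN.
have n1 := nsqD_le u b.
have n2 := nsqD_le (u + b) (- b); rewrite addrK nb in n2.
have e1 : (4 * C)^-1 ^+ 2 = C^-1 ^+ 2 / 16 by field; lra.
have e2 : (2 * C)^-1 ^+ 2 = C^-1 ^+ 2 / 4 by field; lra.
have C2 : 1 <= C ^+ 2 by rewrite expr_ge1//; lra.
have C0 : 0 <= C^-1 by rewrite invr_ge0; lra.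
have C3 : C^-1 <= 1 by rewrite invf_le1//; lra.
have C4 : C^-1 ^+ 2 <= 1 by rewrite exprn_ile1.
have C5 : 0 <= C^-1 ^+ 2 by exact: sqr_ge0.
rewrite e1 in bs; rewrite e2 exprMn.
by apply/andP; split; lra.
Qed.

Lemma fst_sum (I : Type) (r : seq I) (Q : pred I) (G : I -> R * R) :
  (\sum_(i <- r | Q i) G i).1 = \sum_(i <- r | Q i) (G i).1.
Proof. exact: (big_morph (fun u : R * R => u.1) (fun _ _ => erefl) erefl). Qed.

Lemma snd_sum (I : Type) (r : seq I) (Q : pred I) (G : I -> R * R) :
  (\sum_(i <- r | Q i) G i).2 = \sum_(i <- r | Q i) (G i).2.
Proof. exact: (big_morph (fun u : R * R => u.2) (fun _ _ => erefl) erefl). Qed.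
End ComplexPairs.

(** * A finite model of the random variable *)

Section Model.
Context {R : realType} {d : measure_display} {Omega : measurableType d}
  (P : probability Omega R) (xi : nat -> Omega -> R[i]).
Context (iid : iid_complex P xi).
Let X j := cpair (xi j).

Let mX j : measurable_fun setT (X j).
Proof. by have [h _ _] := iid; exact: h. Qed.

Lemma iid_pr (m : nat) (A : nat -> set (R * R)) : (forall j, measurable (A j)) ->
  pr P (\bigcap_(j in [set j | (j < m)%N]) (X j @^-1` A j))
  = \prod_(j < m) pr P (X 0%N @^-1` A j).
Proof.
move=> mA; have [_ ind idd] := iid.
have mXA j : measurable (X 0%N @^-1` A j) by rewrite -[X in measurable X]setTI; exact: mX.
rewrite /pr ind//.
rewrite (eq_bigr (fun j : 'I_m => (pr P (X 0%N @^-1` A j))%:E)); last first.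
  by move=> j _; rewrite idd// -prE//; exact: mXA.
by rewrite -(big_morph EFin EFinM erefl).
Qed.

Lemma measurable_X_preimage j A : measurable A -> measurable (X j @^-1` A).
Proof. by move=> mA; rewrite -[X in measurable X]setTI; exact: mX. Qed.

Lemma measurable_bigcap_X m (A : nat -> set (R * R)) : (forall j, measurable (A j)) ->
  measurable (\bigcap_(j in [set j | (j < m)%N]) (X j @^-1` A j)).
Proof. by move=> mA; apply: bigcap_measurableType => j _; exact: measurable_X_preimage. Qed.

Lemma measurable_fstX j : measurable_fun setT (fun w => (X j w).1).
Proof. exact: measurableT_comp measurable_fst (mX j). Qed.

Lemma measurable_sndX j : measurable_fun setT (fun w => (X j w).2).
Proof. exact: measurableT_comp measurable_snd (mX j). Qed.

Lemma measurable_nsq (S1 S2 : Omega -> R) : measurable_fun setT S1 -> measurable_fun setT S2 ->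
  measurable_fun setT (fun w => nsq (S1 w, S2 w)).
Proof. by move=> m1 m2; apply: measurable_funD; exact: measurable_funX. Qed.

Lemma measurable_sublevel (f : Omega -> R) (a : R) : measurable_fun setT f ->
  measurable [set w | f w <= a].
Proof.
move=> mf; rewrite (_ : [set w | _] = setT `&` f @^-1` [set` `]-oo, a] ]).
  exact: (mf measurableT _ (measurable_itv _)).
by apply/seteqP; split => w /=; rewrite in_itv/=; [|case].
Qed.

Lemma measurable_suplevel (f : Omega -> R) (a : R) : measurable_fun setT f ->
  measurable [set w | a <= f w].
Proof.
move=> mf; rewrite (_ : [set w | _] = setT `&` f @^-1` [set` `[a, +oo[ ]).
  exact: (mf measurableT _ (measurable_itv _)).
by apply/seteqP; split => w /=; rewrite in_itv/= andbT; [|case].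
Qed.

Context (n : nat) (v : {ffun 'I_n -> int * int}).

Lemma measurable_ball (x : R * R) :
  measurable [set w | nsq (\sum_j cmul (v j) (X j w) - x) <= 1].
Proof.
apply: measurable_sublevel.
rewrite (_ : (fun w => _) = fun w => nsq
   (\sum_(j < n) ((v j).1%:~R * (X j w).1 + (- (v j).2%:~R) * (X j w).2) - x.1,
    \sum_(j < n) ((v j).1%:~R * (X j w).2 + (v j).2%:~R * (X j w).1) - x.2)).
  apply: measurable_nsq; apply: measurable_funB => //; apply: measurable_sum => j;
   apply: measurable_funD; apply: measurable_funM => //;
   by [exact: measurable_fstX | exact: measurable_sndX].
apply/funext => w; congr nsq; rewrite [LHS]surjective_pairing /=.
by rewrite fst_sum snd_sum; congr (_ - _, _); apply: eq_bigr => j _; rewrite mulNr.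
Qed.

Lemma measurable_annulus (a b : R) :
  measurable [set w | a <= nsq (X 0%N w - X 1%N w) <= b].
Proof.
have m : measurable_fun setT (fun w => nsq (X 0%N w - X 1%N w)).
  by apply: measurable_nsq; apply: measurable_funB;
    by [exact: measurable_fstX | exact: measurable_sndX].
rewrite (_ : [set w | _] = [set w | a <= nsq (X 0%N w - X 1%N w)] `&`
    [set w | nsq (X 0%N w - X 1%N w) <= b]).
  by apply: measurableI; [exact: measurable_suplevel | exact: measurable_sublevel].
by apply/seteqP; split => w /= => [/andP[]|[-> ->]].
Qed.

(** Round [xi] to a fine grid on a large box. The sum moves by at most 1/2 in each coordinate, so
    the disc of radius 1 goes into that of radius 2; the difference of two copies stays in the
    widened annulus; leaving the box is paid for by a union bound. *)
Lemma finite_model (C rho : R) : 1 <= C -> 0 < rho -> good P xi C ->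
  (rho%:E <= small_ball P xi n 1 v)%E ->
  exists (T : finType) (q : T -> R) (pt : T -> R * R) (x : R * R),
    [/\ forall c, 0 <= q c, \sum_c q c = 1, (2 * C)^-1 <= pair_mass T q pt C &
      rho / 4 <= \sum_(c : {ffun 'I_n -> T} | nsq (\sum_j cmul (v j) (pt (c j)) - x) <= 4)
                   \prod_j q (c j)].
Proof.
move=> C1 rho0 gd sb.
(* The supremum need not be attained, so half of rho is given up to fix a centre. *)
have [x xP] : exists x : R * R, rho / 2 < pr P [set w | nsq (\sum_j cmul (v j) (X j w) - x) <= 1].
  have : ((rho / 2)%:E < small_ball P xi n 1 v)%E.
    by apply: lt_le_trans sb; rewrite lte_fin; lra.
  move=> /ereal_sup_gt[_ [x _ <-] h]; exists (cp x).
  rewrite -lte_fin -prE; last exact: measurable_ball.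
  apply: (lt_le_trans h); rewrite le_eqVlt; apply/orP; left; apply/eqP; congr (P _).
  have e w : \sum_(j < n) cp (gauss (v j) * xi j w) = \sum_j cmul (v j) (X j w).
    by apply: eq_bigr => j _; rewrite cp_gaussM.
  by apply/seteqP; split => w /=; rewrite cnorm_le// cpB cp_sum expr1n e.
pose V : R := \sum_j (`|(v j).1%:~R| + `|(v j).2%:~R|).
(* With this e, some of n copies leaves the box with probability at most rho / 4, and one of two
   copies with probability at most 1 / (2 C). *)
pose e := Num.min (rho / (4 * n.+1%:R)) (1 / (4 * C)).
have n1 : 1 <= n.+1%:R :> R by rewrite ler1n.
have e0 : 0 < e by rewrite lt_min !divr_gt0//; lra.
have [K0 hK0] := grid_box_mass P (X 0%N) e (mX 0%N) e0.
(* K >= 2 V bounds the rounding error V / K of the sum by 1/2, and K >= 8 C that of a difference by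
   1 / (4 C) in each coordinate. *)
pose K := (maxn K0 (maxn (Num.truncn (2 * V)).+1 (Num.truncn (8 * C)).+1)).
have V0 : 0 <= V by apply: sumr_ge0 => j _; rewrite addr_ge0.
have K_V : 2 * V <= K%:R.
  have /andP[_ h] := truncn_itv (mulr_ge0 (ler0n R 2) V0).
  by apply: (le_trans (ltW h)); rewrite ler_nat /K !leq_max !leqnn !orbT.
have K_C : 8 * C <= K%:R.
  have /andP[_ h] := truncn_itv (mulr_ge0 (ler0n R 8) (le_trans ler01 C1)).
  by apply: (le_trans (ltW h)); rewrite ler_nat /K !leq_max !leqnn !orbT.
have K_0 : (0 < K)%N by rewrite /K !leq_max /= orbT.
have KR : 0 < K%:R :> R by rewrite ltr0n.
have outK := hK0 K (leq_maxl _ _); clearbody K.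
pose T : finType := option ('I_(2 * K * K) * 'I_(2 * K * K)).
pose q (c : T) := pr P (X 0%N @^-1` grid_cell K c).
pose pt : T -> R * R := grid_pt K.
have mcell (c : T) : measurable (grid_cell K c : set (R * R)) := measurable_grid_cell K c.
have qN : q None <= e by [].
have prX j c : pr P (X j @^-1` grid_cell K c) = q c.
  by rewrite /q /pr; have [_ _ ->] := iid.
have cellX j w : exists c : T, grid_cell K c (X j w) by exact: grid_cell_exists.
have iKV : V * K%:R^-1 <= 1 / 2 by rewrite ler_pdivrMr//; lra.
have iKC : K%:R^-1 <= (8 * C)^-1 by rewrite lef_pV2 ?posrE//; lra.
have e4C : 2 * (8 * C)^-1 = (4 * C)^-1 by field; lra.
have iK0 : 0 < K%:R^-1 :> R by rewrite invr_gt0.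
have eC : e <= 1 / (4 * C) by rewrite ge_min lexx orbT.
have eR : e <= rho / (4 * n.+1%:R) by rewrite ge_min lexx.
exists T, q, pt, x; split.
- by move=> c; exact: pr_ge0.
- apply: pr_partition.
  + by move=> c; exact: measurable_X_preimage.
  + by move=> c c' _ _ [w [h1 h2]]; exact: (grid_cell_inj K _ _ _ K_0 h1 h2).
  + by move=> w; exact: cellX.
- pose A (zz : T * T) (j : nat) : set (R * R) := grid_cell K (if j == 0%N then zz.1 else zz.2).
  pose E (i : (T * T) + bool) : set Omega := match i with
    | inl zz => \bigcap_(j in [set j | (j < 2)%N]) (X j @^-1` A zz j)
    | inr b => X b @^-1` grid_cell K None end.
  pose G (i : (T * T) + bool) := if i is inl zz then good_pair T pt C zz else true.
  have mE i : measurable (E i).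
    case: i => [zz|b] /=; last by apply: measurable_X_preimage; exact: (mcell None).
    by apply: measurable_bigcap_X => j; exact: mcell.
  have cov : [set w | C^-1 ^+ 2 <= nsq (X 0%N w - X 1%N w) <= C ^+ 2] `<=`
      [set w | exists2 i, G i & E i w].
    move=> w /= /andP[lo hi].
    have [c0 h0] := cellX 0%N w; have [c1 h1] := cellX 1%N w.
    case: c0 h0 => [[i0 j0]|] h0; last by exists (inr false).
    case: c1 h1 => [[i1 j1]|] h1; last by exists (inr true).
    exists (inl (Some (i0, j0), Some (i1, j1))) => /=; last by move=> [|[|]].
    have [a1 a2] := grid_cell_close K _ i0 j0 K_0 h0.
    have [b1 b2] := grid_cell_close K _ i1 j1 K_0 h1.
    rewrite /good_pair -/pt /=.
    set u0 := grid_pt K (Some (i0, j0)) in a1 a2 *.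
    set u1 := grid_pt K (Some (i1, j1)) in b1 b2 *.
    change (pt (Some (i0, j0))) with u0; change (pt (Some (i1, j1))) with u1.
    set b := (u0 - u1) - (X 0%N w - X 1%N w).
    have ub (s t : R) : `|s| <= K%:R^-1 -> `|t| <= K%:R^-1 -> (s - t) ^+ 2 <= (4 * C)^-1 ^+ 2.
      by rewrite -e4C => hs ht; apply: sqrB_le; [apply: le_trans hs iKC | apply: le_trans ht iKC].
    have bs : nsq b <= 2 * (4 * C)^-1 ^+ 2.
      rewrite /nsq (_ : b.1 = (u0.1 - (X 0%N w).1) - (u1.1 - (X 1%N w).1)); last by rewrite /b /=; ring.
      rewrite (_ : b.2 = (u0.2 - (X 0%N w).2) - (u1.2 - (X 1%N w).2)); last by rewrite /b /=; ring.
      by rewrite mulr_natl mulr2n lerD// ub.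
    have -> : u0 - u1 = (X 0%N w - X 1%N w) + b by rewrite /b [RHS]addrC subrK.
    by apply: nsq_annulus_perturb => //; rewrite lo.
  have := pr_cover P _ G _ E (measurable_annulus _ _) mE cov.
  rewrite big_sumType/= big_bool/= (prX 0%N None) (prX 1%N None).
  have -> : \sum_(i | good_pair T pt C i) pr P (\bigcap_(j in [set j | (j < 2)%N]) (X j @^-1` A i j))
      = pair_mass T q pt C.
    apply: eq_bigr => zz _; rewrite iid_pr; last by move=> j; exact: mcell.
    by rewrite !big_ord_recl big_ord0 /= mulr1.
  have : C^-1 <= pr P [set w | C^-1 ^+ 2 <= nsq (X 0%N w - X 1%N w) <= C ^+ 2].
    rewrite -lee_fin -prE; last exact: measurable_annulus.
    apply: (le_trans gd); rewrite le_eqVlt; apply/orP; left; apply/eqP; congr (P _).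
    have c0 : 0 <= C by lra. have c1 : 0 <= C^-1 by rewrite invr_ge0.
    by apply/seteqP; split => w /=; rewrite cnorm_le// cnorm_ge// cpB.
  have -> : (2 * C)^-1 = C^-1 - 2 * (1 / (4 * C)) by field; lra.
  lra.
(* The family is indexed by all natural numbers; from n on it imposes nothing. *)
- pose A (c : {ffun 'I_n -> T}) (j : nat) : set (R * R) :=
    if insub j is Some i then grid_cell K (c i) else setT.
  have mA c j : measurable (A c j) by rewrite /A; case: insub => // i; exact: mcell.
  pose E (i : {ffun 'I_n -> T} + 'I_n) : set Omega := match i with
    | inl c => \bigcap_(j in [set j | (j < n)%N]) (X j @^-1` A c j)
    | inr j => X j @^-1` grid_cell K None end.
  pose G (i : {ffun 'I_n -> T} + 'I_n) :=
    if i is inl c then nsq (\sum_j cmul (v j) (pt (c j)) - x) <= 4 else true.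
  have mE i : measurable (E i).
    by case: i => [c|j] /=; [exact: measurable_bigcap_X | apply: measurable_X_preimage; exact: (mcell None)].
  have cov : [set w | nsq (\sum_j cmul (v j) (X j w) - x) <= 1] `<=`
      [set w | exists2 i, G i & E i w].
    move=> w /= hw.
    pose c := [ffun j : 'I_n => sval (cid (cellX j w))].
    have cP (j : 'I_n) : grid_cell K (c j) (X j w) by rewrite ffunE; exact: (svalP (cid (cellX j w))).
    have [[j cj]|nc] := pselect (exists j, c j = None).
      by exists (inr j) => //; have := cP j; rewrite cj.
    exists (inl c) => /=; last first.
      by move=> j /= jn; rewrite /A insubT /=; exact: (cP (Ordinal jn)).
    set b := \sum_j cmul (v j) (pt (c j) - X j w).
    have -> : \sum_j cmul (v j) (pt (c j)) - x = (\sum_j cmul (v j) (X j w) - x) + b.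
      rewrite addrAC -big_split/=; congr (_ - _); apply: eq_bigr => j _.
      by rewrite cmulBr addrC subrK.
    have close (j : 'I_n) : `|(pt (c j)).1 - (X j w).1| <= K%:R^-1 /\ `|(pt (c j)).2 - (X j w).2| <= K%:R^-1.
      case e1 : (c j) => [[i1 i2]|]; last by case: nc; exists j.
      by apply: grid_cell_close => //; rewrite -e1.
    have b1 : `|b.1| <= 1 / 2.
      apply: le_trans iKV; rewrite /b fst_sum mulr_suml; apply: (le_trans (ler_norm_sum _ _ _)).
      apply: ler_sum => j _; have [h1 h2] := close j.
      rewrite /cmul /=; apply: (le_trans (ler_normB _ _)); rewrite !normrM mulrDl.
      by rewrite lerD// ler_wpM2l.
    have b2 : `|b.2| <= 1 / 2.
      apply: le_trans iKV; rewrite /b snd_sum mulr_suml; apply: (le_trans (ler_norm_sum _ _ _)).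
      apply: ler_sum => j _; have [h1 h2] := close j.
      rewrite /cmul /=; apply: (le_trans (ler_normD _ _)); rewrite !normrM mulrDl.
      by rewrite lerD// ler_wpM2l.
    have nb := nsq_le_half b b1 b2.
    apply: (le_trans (nsqD_le _ _)).
    have -> : 4 = 2 * 1 + 2 * 1 :> R by ring.
    by rewrite lerD// ler_pM2l//; apply: (le_trans nb); lra.
  have := pr_cover P _ G _ E (measurable_ball x) mE cov.
  rewrite big_sumType/=.
  have -> : \sum_(i < n) pr P (X i @^-1` (~` grid_box K)) = n%:R * q None.
    rewrite (eq_bigr (fun=> q None)); last by move=> i _; exact: (prX i None).
    by rewrite sumr_const card_ord mulr_natl.
  have -> : \sum_(c : {ffun 'I_n -> T} | nsq (\sum_j cmul (v j) (pt (c j)) - x) <= 4)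
       pr P (\bigcap_(j in [set j | (j < n)%N]) (X j @^-1` A c j))
     = \sum_(c : {ffun 'I_n -> T} | nsq (\sum_j cmul (v j) (pt (c j)) - x) <= 4) \prod_j q (c j).
    apply: eq_bigr => c _; rewrite iid_pr//; apply: eq_bigr => j _.
    by rewrite /A valK.
  have : n%:R * q None <= rho / 4.
    apply: (@le_trans _ _ (n.+1%:R * (rho / (4 * n.+1%:R)))).
      apply: ler_pM => //; first exact: pr_ge0.
        by rewrite ler_nat.
      exact: le_trans qN eR.
    by rewrite le_eqVlt; apply/orP; left; apply/eqP; field; lra.
  lra.
Qed.
End Model.

(** * The counting bound *)

Section Bridge.
Local Open Scope set_scope.
Local Open Scope ring_scope.
Context {R : realType} (p : nat) (p_pr : prime p) (n : nat).
Local Notation F := ('F_p * 'F_p)%type.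
Local Notation vec := {ffun 'I_n -> F}.

Let pp0 : 0 < p%:R ^+ 2 :> R.
Proof. by rewrite exprn_gt0// ltr0n prime_gt0. Qed.

Lemma ler_favg (f g : F -> R) : (forall t, f t <= g t) -> favg p f <= favg p g.
Proof. by move=> fg; rewrite ler_wpM2r ?invr_ge0 ?(ltW pp0)// ler_sum. Qed.

Lemma favg_affine (f : F -> R) (u w : R) : favg p (fun t => f t * u - w) = favg p f * u - w.
Proof.
rewrite /favg sumrB -mulr_suml mulrBl mulrAC; congr (_ - _).
by rewrite sumr_const card_prod card_Fp// -[w *+ _]mulr_natr natrM -expr2 mulfK// gt_eqF.
Qed.

(** Factors outside [I] lie in [0, 1] and are dropped; the others are bounded by 1 - x <= exp (-
    x). *)
Lemma walk_return_le (C lam : R) (v : {ffun 'I_n -> int * int}) (I : {set 'I_n}) :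
  1 <= C -> lam = 1 / (8 * C) ->
  walk_return p C n v <= favg p (fun t => expR (- (lam * defect p n I (phi_p p n v) t))).
Proof.
move=> C1 ->; set a := phi_p p n v; set lam' := 1 / (8 * C).
have l0 : 0 < lam' by apply: divr_gt0; lra.
have l1 : lam' <= 1 / 8 by rewrite /lam' ler_pdivrMr; lra.
rewrite /walk_return -/a -/lam'; apply: ler_favg => t.
have f01 j : 0 <= 1 - lam' + lam' * ch p t (a j) <= 1.
  have := ch_norm_le1 p t (a j) (R := R); rewrite ler_norml => /andP[c1 c2].
  by apply/andP; split; nra.
rewrite (bigID (mem I))/= /defect mulr_sumr -sumrN expR_sum -[leRHS]mulr1.
apply: ler_pM.
- by apply: prodr_ge0 => j _; have /andP[] := f01 j.
- by apply: prodr_ge0 => j _; have /andP[] := f01 j.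
- apply: ler_prod => j _; have /andP[-> _] /= := f01 j.
  by apply: le_trans (expR_ge1Dx _); lra.
- by apply: prodr_ile1 => j; have := f01 j.
Qed.

(** Average [sum_cos_power_ge] over t: the sum over [I :\ i] is h - c_i, so the right-hand side
    becomes a weighted count of relations for a_i that avoid the index i. *)
Lemma sum_nrep_ge (I : {set 'I_n}) (a : vec) (k : nat) : (0 < k)%N -> (k <= #|I|)%N ->
  #|I|%:R ^+ (2 * k) * (favg p (fun t => ((\sum_(i in I) ch p t (a i)) / #|I|%:R) ^+ (2 * k)) / 2)
    - (16 * k%:R * #|I|%:R) ^+ k
  <= \sum_(i in I) nrep p n (I :\ i) (2 * k).-1 a (a i) :> R.
Proof.
move=> k0 kI; have m0 : #|I|%:R != 0 :> R by rewrite pnatr_eq0 -lt0n (leq_trans k0).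
set m := #|I|%:R in m0 *.
have -> : \sum_(i in I) nrep p n (I :\ i) (2 * k).-1 a (a i)
  = favg p (fun t => \sum_(i in I) ch p t (a i) * (\sum_(j in I) ch p t (a j) - ch p t (a i)) ^+ (2 * k).-1) :> R.
  rewrite /nrep /favg exchange_big/= mulr_suml; apply: eq_bigr => i iI.
  congr (_ / _); apply: eq_bigr => t _; congr (_ * _ ^+ _).
  rewrite [in RHS](bigD1 i)//= addrAC subrr add0r; apply: eq_bigl => j.
  by rewrite !inE andbC.
rewrite [leLHS](_ : _ = favg p (fun t => ((\sum_(i in I) ch p t (a i)) / m) ^+ (2 * k))
  * (m ^+ (2 * k) / 2) - (16 * k%:R * m) ^+ k); last by ring.
rewrite -favg_affine; apply: ler_favg => t.
apply: le_trans (sum_cos_power_ge _ I (fun i => ch p t (a i)) k k0 kI _); last first.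
  by move=> i; exact: ch_norm_le1.
rewrite -/m lerD2r expr_div_n mulrA mulfVK ?expf_neq0//.
Qed.

Lemma expR1_le4 : expR 1 <= 4 :> R.
Proof.
have h : 1 / 2 <= expR (- (1 / 2)) :> R by apply: le_trans (expR_ge1Dx _); lra.
have : (1 / 2) ^+ 2 <= expR (- (1 / 2)) ^+ 2 :> R by rewrite lerXn2r ?nnegrE ?expR_ge0.
rewrite -expRM_natr (_ : - (1 / 2) * 2 = -1 :> R); last by field.
rewrite expRN => h2; have e0 := @expR_gt0 R 1.
have e1 : (expR 1)^-1 * expR 1 = 1 :> R by rewrite mulVf// gt_eqF.
nra.
Qed.

(** A single term of the exponential series: s^s / s! <= e^s. *)
Lemma pow_self_le_fact (s : nat) : s%:R ^+ s <= 5 ^+ s * s`!%:R :> R.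
Proof.
case: s => [|s]; first by rewrite !expr0 mul1r fact0.
have h := @expR_ge1Dxn R s.+1%:R s (ler0n _ _).
have f0 : 0 < s.+1`!%:R :> R by rewrite ltr0n fact_gt0.
have e : expR s.+1%:R <= 5 ^+ s.+1 :> R.
  rewrite -[s.+1%:R]mul1r expRM_natr lerXn2r ?nnegrE ?expR_ge0//.
  by have := expR1_le4; lra.
rewrite -ler_pdivrMr//; lra.
Qed.

Lemma leq_card_bigcup (I T : finType) (Q : pred I) (S : I -> {set T}) :
  (#|\bigcup_(i | Q i) S i| <= \sum_(i | Q i) #|S i|)%N.
Proof.
elim/big_ind2: _ => [|x X y Y hX hY|//]; first by rewrite cards0.
by rewrite (leq_trans (leq_card_setU X Y).1) ?leq_add.
Qed.

(** Enlarge each support to exactly [s] indices: there are at most C(n, s) p^(2s) such vectors, and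
    C(n, s) <= n^s / s! <= (5 n / s)^s. *)
Lemma card_small_support (s : nat) : (0 < s <= n)%N ->
  #|[set a : vec | (#|[set j | a j != 0%R]| <= s)%N]|%:R <= (5 * n%:R * p%:R ^+ 2 / s%:R) ^+ s :> R.
Proof.
move=> /andP[s0 sn].
pose Js := [set J : {set 'I_n} | #|J| == s].
pose SJ (J : {set 'I_n}) := [set a : vec | [forall j, (j \notin J) ==> (a j == 0)]].
have sub : [set a : vec | (#|[set j | a j != 0%R]| <= s)%N] \subset \bigcup_(J in Js) SJ J.
  apply/fintype.subsetP => a; rewrite inE => ha.
  have [J aJ cJ] : exists2 J : {set 'I_n}, [set j | a j != 0%R] \subset J & #|J| = s.
    suff ext m : forall J0 : {set 'I_n}, [set j | a j != 0%R] \subset J0 -> (s - #|J0| = m)%N ->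
        (#|J0| <= s)%N -> exists2 J : {set 'I_n}, [set j | a j != 0%R] \subset J & #|J| = s.
      exact: ext (subxx _) erefl ha.
    elim: m => [|m IH] J aJ e hJ.
      by exists J => //; apply/eqP; rewrite eqn_leq hJ -subn_eq0 e.
    have : (0 < #|~: J|)%N.
      rewrite cardsCs finset.setCK card_ord subn_gt0; apply: leq_trans sn; by rewrite -subn_gt0 e.
    case/card_gt0P => i; rewrite inE => iJ.
    have cJ : #|i |: J| = #|J|.+1 by rewrite cardsU1 iJ.
    by apply: (IH (i |: J)); rewrite ?cJ; [exact: fintype.subset_trans aJ (finset.subsetUr _ _)|rewrite subnS e|rewrite -subn_gt0 e].
  apply/finset.bigcupP; exists J; first by rewrite inE cJ.
  rewrite inE; apply/forallP => j; apply/implyP; apply: contraNT => aj.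
  by apply: (fintype.subsetP aJ); rewrite inE.
have c1 : (#|[set a : vec | (#|[set j | a j != 0%R]| <= s)%N]| <= 'C(n, s) * (p ^ 2) ^ s)%N.
  apply: (leq_trans (subset_leq_card sub)); apply: (leq_trans (leq_card_bigcup _ _ _ _)).
  rewrite (eq_bigr (fun=> (p ^ 2) ^ s)%N); last first.
    by move=> J; rewrite inE => /eqP cJ; rewrite card_supp_le// cJ.
  by rewrite sum_nat_const card_draws card_ord.
have c2 : 'C(n, s)%:R * s`!%:R <= n%:R ^+ s :> R.
  rewrite -natrM bin_ffact -natrX ler_nat.
  elim: s {s0 Js SJ sub c1} sn => [|s IH] //=.
  by move=> sn; rewrite ffactnSr expnSr leq_mul ?IH ?leq_subr// ltnW.
have s1 : 0 < s%:R :> R by rewrite ltr0n.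
have f0 : 0 < s`!%:R :> R by rewrite ltr0n fact_gt0.
apply: (@le_trans _ _ ('C(n, s) * (p ^ 2) ^ s)%:R); first by rewrite ler_nat.
have -> : (5 * n%:R * p%:R ^+ 2 / s%:R) ^+ s = (5 ^+ s * n%:R ^+ s / s%:R ^+ s) * (p%:R ^+ 2) ^+ s :> R.
  by rewrite -!exprMn -expr_div_n -exprMn; congr (_ ^+ _); field; rewrite gt_eqF.
rewrite natrM !natrX ler_wpM2r ?exprn_ge0//.
rewrite ler_pdivlMr ?exprn_gt0//.
have := pow_self_le_fact s; have b0 : 0 <= 'C(n, s)%:R :> R by [].
have p5 : 0 <= 5 ^+ s :> R by rewrite exprn_ge0.
move=> h1; apply: (@le_trans _ _ ('C(n, s)%:R * (5 ^+ s * s`!%:R))); first by rewrite ler_wpM2l.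
by rewrite mulrCA ler_wpM2l.
Qed.
End Bridge.

(** * Elementary estimates for the parameters *)

Section Exponents.
Context {R : realType}.

(** Makes the error term of [sum_cos_power_ge] negligible. With u = s^(1/4) it is the k-th power of
    16 k m u <= m^2, which holds as 16 <= u and k <= u^2 give 16 k u <= u^4 = s <= m. *)
Lemma trivial_solutions_le (s k : nat) (m : R) : 256 <= Num.sqrt (s%:R : R) ->
  k%:R <= Num.sqrt (s%:R : R) -> s%:R <= m ->
  (16 * k%:R * m) ^+ k <= m ^+ (2 * k) * (s%:R : R) `^ (- (k%:R / 4)).
Proof.
move=> s256 ks sm.
pose u : R := Num.sqrt (Num.sqrt s%:R).
have u0 : 0 <= u by exact: sqrtr_ge0.
have u2 : u ^+ 2 = Num.sqrt s%:R by rewrite sqr_sqrtr// sqrtr_ge0.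
have u4 : u ^+ 4 = s%:R by rewrite (exprM u 2 2) u2 sqr_sqrtr.
have u16 : 16 <= u by rewrite -(@ler_pXn2r _ 2)// ?nnegrE// u2; lra.
have pE : (s%:R : R) `^ (- (k%:R / 4)) = (u ^+ k)^-1.
  rewrite powRN -u4 -powR_mulrn// -powRrM -powR_mulrn//; congr (_ `^ _)^-1.
  by field.
have uk : 0 < u ^+ k by rewrite exprn_gt0//; lra.
have m0 : 0 <= m by apply: le_trans sm.
rewrite pE ler_pdivlMr// exprM -exprMn lerXn2r ?nnegrE ?exprn_ge0 ?mulr_ge0//.
have h : 16 * k%:R * u <= m.
  apply: le_trans sm; rewrite -u4.
  have -> : u ^+ 4 = u * u ^+ 2 * u by ring.
  by rewrite ler_wpM2r// ler_pM// u2.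
by rewrite mulrAC expr2 ler_wpM2r.
Qed.

Lemma le_of_le_divr_ln (s n : nat) : (8 <= s)%N -> s%:R <= n%:R / ln (n%:R : R) -> (s <= n)%N.
Proof.
move=> s8 h; have s8R : 8 <= s%:R :> R by rewrite (ler_nat _ 8).
(* For n = 0 and n = 1 the quotient evaluates to 0, which is below s. *)
case: n h => [|[|n]].
- by rewrite mul0r; lra.
- by rewrite ln1 invr0 mulr0; lra.
set x : R := n.+2%:R => h.
have x2 : 2 <= x by rewrite /x (ler_nat _ 2).
have lnP (a : R) : expR a <= x -> a <= ln x.
  by move=> ax; rewrite -ler_expR lnK// posrE; lra.
have e4 := @expR1_le4 R.
have e2 : expR (1 / 2) <= 2 :> R.
  rewrite -(@ler_pXn2r _ 2)// ?nnegrE ?expR_ge0// -expRM_natr.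
  by rewrite (_ : 1 / 2 * 2 = 1 :> R); [lra|field].
(* A bootstrap: ln x >= 1/2 gives x >= s / 2 >= 4 >= e, whence ln x >= 1 and s <= x. *)
have l2 : 1 / 2 <= ln x by apply: lnP; lra.
have hx : s%:R * ln x <= x by rewrite -ler_pdivlMr//; lra.
have x4 : 4 <= x by nra.
have l1 : 1 <= ln x by apply: lnP; lra.
by rewrite -(ler_nat R) -/x; nra.
Qed.
End Exponents.

(** * Assembling the bound *)

Section Main.
Local Open Scope set_scope.
Local Open Scope ring_scope.
Context {R : realType} {d : measure_display} {Omega : measurableType d}
  (P : probability Omega R) (xi : nat -> Omega -> R[i]) (C : R).
Context (iid : iid_complex P xi) (gd : good P xi C) (C1 : 1 <= C).
Let lam : R := 1 / (8 * C).

(** 8 is the 4 lost in [finite_model] times the 2 of [small_ball_le_walk_return]. *)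
Definition ball_const : R := 8 * (1 + 4 * (256 * C ^+ 2)) ^+ 2.
Definition subgroup_const : R := ball_const * (1 - expR (- lam)) ^- 2.
Definition growth_const : R := 6 * expR (32 * C) * subgroup_const.
Definition tail_const : R := ball_const * expR lam.

Lemma ball_const_gt0 : 0 < ball_const.
Proof.
rewrite /ball_const mulr_gt0// exprn_gt0// ltr_pwDl// mulr_ge0// mulr_ge0//.
exact: sqr_ge0.
Qed.

Lemma subgroup_const_gt0 : 0 < subgroup_const.
Proof.
move: (C1) => C1'; have l0 : 0 < lam by apply: divr_gt0; lra.
rewrite mulr_gt0 ?ball_const_gt0// invr_gt0 exprn_gt0// subr_gt0 expR_lt1; lra.
Qed.

Lemma growth_const_gt0 : 0 < growth_const.
Proof. by rewrite mulr_gt0 ?subgroup_const_gt0// mulr_gt0// expR_gt0. Qed.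

Lemma tail_const_gt0 : 0 < tail_const.
Proof. by rewrite mulr_gt0 ?ball_const_gt0// expR_gt0. Qed.

Context (p : nat) (p_pr : prime p) (n : nat).
Local Notation F := ('F_p * 'F_p)%type.

Lemma rho_le (v : {ffun 'I_n -> int * int}) (rho : R) (k : nat) (I : {set 'I_n}) :
  0 < rho -> Vrho P xi n rho v -> (forall i, i \in I -> phi_p p n v i != 0) ->
  (0 < #|I|)%N -> 32 * C <= k%:R ->
  rho <= subgroup_const / p%:R + growth_const * (Num.sqrt (k%:R / #|I|%:R)
       * favg p (fun t => ((\sum_(i in I) ch p t (phi_p p n v i)) / #|I|%:R) ^+ (2 * k)))
     + tail_const * expR (- (#|I|%:R / k%:R)).
Proof.
move=> rho0 hv vI I0 Ck.
have [T [q [pt [x [q0 q1 gp sb]]]]] := finite_model P xi iid n v C rho C1 rho0 gd hv.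
have h1 := small_ball_le_walk_return p p_pr C n v C1 T q pt q0 q1 gp x.
have h2 := walk_return_le p p_pr n C lam v I C1 erefl.
have h3 := halasz p p_pr n I (phi_p p n v) C lam k erefl vI I0 C1 Ck.
have b0 := ball_const_gt0.
have h : rho <= ball_const * walk_return p C n v by rewrite /ball_const; lra.
apply: (le_trans h).
apply: (le_trans (ler_wpM2l (ltW b0) (le_trans h2 h3))).
by rewrite le_eqVlt; apply/orP; left; apply/eqP; rewrite /growth_const /subgroup_const /tail_const; ring.
Qed.

(** In [rho_le] the terms with 1 / p and with the exponential are at most rho / 4 each, so the
    middle term is at least rho / 2. Hence the average of (h / m)^(2k) is large for every [I], and
    [sum_nrep_ge] turns this into relations. *)
Lemma phi_p_bad (v : {ffun 'I_n -> int * int}) (rho C' : R) (s k : nat) :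
  4 * subgroup_const <= C' -> 4 * tail_const <= C' -> 8 * growth_const <= C' ->
  0 < rho -> Vrho P xi n rho v -> 1000 * C <= k%:R -> k%:R <= Num.sqrt (s%:R : R) ->
  C' * expR (- (s%:R / k%:R)) <= rho -> C' * (s%:R : R) `^ (- (k%:R / 4)) <= rho ->
  C' / rho <= p%:R ->
  phi_p p n v \in bad p n (rho * Num.sqrt (s%:R / k%:R) / (8 * growth_const)) s (2 * k).-1
    [set j | phi_p p n v j != 0].
Proof.
move=> c1 c2 c3 rho0 hv kC ks hexp hpow hp.
have sg0 := subgroup_const_gt0; have tg0 := tail_const_gt0; have gg0 := growth_const_gt0.
have C'0 : 0 < C' by lra.
have k1000 : 1000 <= k%:R :> R by move: (C1) => ?; lra.
have s256 : 256 <= Num.sqrt (s%:R : R) by lra.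
have k0 : 0 < k%:R :> R by lra.
have sk : k%:R ^+ 2 <= s%:R :> R.
  by rewrite -[leRHS]sqr_sqrtr// lerXn2r ?nnegrE//; lra.
have kls : k%:R <= s%:R :> R by nra.
have p0 : 0 < p%:R :> R by rewrite ltr0n prime_gt0.
rewrite inE; apply/andP; split.
  by apply/forallP => j; apply/implyP; rewrite inE negbK.
apply/forallP => I; apply/implyP => /andP[IJ sI].
set a := phi_p p n v.
set m : R := #|I|%:R.
have sm : s%:R <= m by rewrite ler_nat ltnW.
have m0 : 0 < m by lra.
have aI i : i \in I -> a i != 0 by move=> /(fintype.subsetP IJ); rewrite inE.
have I0 : (0 < #|I|)%N by exact: leq_ltn_trans sI.
have h := rho_le v rho k I rho0 hv aI I0 ltac:(lra).
rewrite -/a -/m in h.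
set G := favg p _ in h.
have k_nat : (0 < k)%N by rewrite -(ltr_nat R).
have kI : (k <= #|I|)%N by rewrite -(ler_nat R) -/m; lra.
have W := sum_nrep_ge p p_pr n I a k k_nat kI (R := R).
rewrite -/m -/G in W.
have e2k : (2 * k).-1.+1 = (2 * k)%N by rewrite prednK// muln_gt0.
rewrite e2k; apply: le_trans W.
have t1 : subgroup_const / p%:R <= rho / 4.
  rewrite ler_pdivrMr//; rewrite ler_pdivrMr// in hp; nra.
have t2 : tail_const * expR (- (m / k%:R)) <= rho / 4.
  have e1 : expR (- (m / k%:R)) <= expR (- (s%:R / k%:R)).
    by rewrite ler_expR lerN2 ler_wpM2r// invr_ge0 ltW.
  have e0 := expR_ge0 (- (m / k%:R)); nra.
have G0 : 0 <= G.
  apply: divr_ge0; last exact: sqr_ge0.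
  by apply: sumr_ge0 => t _; rewrite exprM exprn_ge0// sqr_ge0.
set rt := Num.sqrt (s%:R / k%:R).
have rt1 : 1 <= rt.
  by rewrite -[leLHS]sqrtr1 ler_wsqrtr// ler_pdivlMr// mul1r.
have t3 : rho / 2 * rt <= growth_const * G.
  have h4 : rho / 2 <= growth_const * (Num.sqrt (k%:R / m) * G) by lra.
  (* Since m >= s, the factor sqrt (k / m) is at most 1 / rt. *)
  have sq1 : Num.sqrt (k%:R / m) * rt <= 1.
    rewrite /rt -sqrtrM ?divr_ge0 ?(ltW k0) ?(ltW m0)// -[leRHS]sqrtr1 ler_wsqrtr//.
    have -> : k%:R / m * (s%:R / k%:R) = s%:R / m :> R by field; rewrite !gt_eqF.
    by rewrite ler_pdivrMr// mul1r.
  have gG : 0 <= growth_const * G by rewrite mulr_ge0// ltW.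
  have rt0 : 0 <= rt by lra.
  have := ler_wpM2r rt0 h4; nra.
have t4 := trivial_solutions_le s k m s256 ks sm.
have m2 : 0 < m ^+ (2 * k) by rewrite exprn_gt0.
have pw0 := powR_ge0 (s%:R : R) (- (k%:R / 4)).
set pw := (s%:R : R) `^ _ in t4 pw0 hpow.
(* With theta the left side, G / 2 >= 2 theta and the error [pw] is at most theta. *)
suff : rho * rt / (8 * growth_const) <= G / 2 - pw.
  by move=> hs; have := ler_wpM2l (ltW m2) hs; rewrite mulrBr; lra.
have t5 : pw <= rho * rt / (8 * growth_const).
  by rewrite ler_pdivlMr; [nra | rewrite mulr_gt0].
have t6 : rho * rt / (2 * growth_const) <= G.
  by rewrite ler_pdivrMr; [lra | rewrite mulr_gt0].
have e8 : rho * rt / (2 * growth_const) = 4 * (rho * rt / (8 * growth_const)).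
  by field; rewrite gt_eqF.
lra.
Qed.

(** Vectors with at most s nonzero coordinates modulo p give the first term. Any other is bad for
    its own support J; the at most 2^n sets J contribute (2 * 4 / theta)^n, and 8 / theta is 64
    [growth_const] / (rho rt). *)
Lemma card_phi_image_le (rho C' : R) (s k : nat) :
  4 * subgroup_const <= C' -> 4 * tail_const <= C' -> 64 * growth_const <= C' ->
  0 < rho -> 1000 * C <= k%:R -> k%:R <= Num.sqrt (s%:R : R) -> s%:R <= n%:R / ln (n%:R : R) ->
  C' * expR (- (s%:R / k%:R)) <= rho -> C' * (s%:R : R) `^ (- (k%:R / 4)) <= rho ->
  C' / rho <= p%:R -> p%:R <= (2 : R) `^ (n%:R / s%:R) ->
  (#|phi_image p n (Vrho P xi n rho)|)%:R
      <= (5 * n%:R * p%:R ^+ 2 / s%:R) ^+ s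
         + (C' / rho / Num.sqrt (s%:R / k%:R : R)) ^+ n.
Proof.
move=> c1 c2 c3 rho0 kC ks sn hexp hpow hp p2.
have gg0 := growth_const_gt0.
have k1000 : 1000 <= k%:R :> R by move: (C1) => ?; lra.
have k0 : 0 < k%:R :> R by lra.
have sk : k%:R ^+ 2 <= s%:R :> R.
  by rewrite -[leRHS]sqr_sqrtr// lerXn2r ?nnegrE//; lra.
have s8R : 8 <= s%:R :> R by nra.
have s8 : (8 <= s)%N by rewrite -(ler_nat R).
have s0 : 0 < s%:R :> R by lra.
have sn' : (s <= n)%N := le_of_le_divr_ln s n s8 sn.
set rt := Num.sqrt (s%:R / k%:R : R).
have rt0 : 0 < rt by rewrite sqrtr_gt0 divr_gt0.
set th := rho * rt / (8 * growth_const).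
have th0 : 0 < th by rewrite divr_gt0// mulr_gt0.
have p0 : 0 < p%:R :> R by rewrite ltr0n prime_gt0.
pose S1 := [set a : {ffun 'I_n -> F} | (#|[set j | a j != 0%R]| <= s)%N].
pose S2 := \bigcup_(J : {set 'I_n} | (s < #|J|)%N) bad p n th s (2 * k).-1 J.
have sub : phi_image p n (Vrho P xi n rho) \subset S1 :|: S2.
  apply/fintype.subsetP => a; rewrite inE => /asboolP[v hv <-].
  rewrite finset.in_setU; have [small|big] := leqP #|[set j | phi_p p n v j != 0%R]| s.
    by rewrite inE small.
  apply/orP; right; apply/finset.bigcupP; exists [set j | phi_p p n v j != 0%R] => //.
  by apply: (phi_p_bad v rho C' s k c1 c2 _ rho0 hv kC ks hexp hpow hp); lra.
apply: (@le_trans _ _ (#|S1|%:R + #|S2|%:R)).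
  rewrite -natrD ler_nat; apply: (leq_trans (subset_leq_card sub)).
  exact: (leq_card_setU S1 S2).1.
apply: lerD.
  by apply: card_small_support => //; rewrite sn' andbT (leq_trans _ s8).
have base0 : 0 <= C' / rho / rt by rewrite !divr_ge0 ?ltW//; lra.
(* A threshold above 1 leaves no bad vector; otherwise theta^-(|J| - s) <= theta^-n. *)
have [th1|th1] := leP th 1; last first.
  rewrite /S2 big1 ?cards0 ?exprn_ge0// => J sJ; exact: bad_empty.
(* The upper bound on p enters here: the s free coordinates cost at most 4^n. *)
have ps : p%:R ^+ (2 * s) <= 4 ^+ n :> R.
  have h : p%:R ^+ s <= 2 ^+ n :> R.
    have -> : 2 ^+ n = ((2 : R) `^ (n%:R / s%:R)) ^+ s.
      by rewrite -[RHS]powR_mulrn ?powR_ge0// -powRrM mulfVK ?gt_eqF// powR_mulrn.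
    by rewrite lerXn2r ?nnegrE ?powR_ge0// ltW.
  have -> : 4 = 2 ^+ 2 :> R by ring.
  by rewrite mulnC exprM [leRHS]exprAC lerXn2r ?nnegrE ?exprn_ge0// ltW.
apply: (@le_trans _ _ (\sum_(J : {set 'I_n} | (s < #|J|)%N) 4 ^+ n / th ^+ n)).
  apply: (@le_trans _ _ (\sum_(J : {set 'I_n} | (s < #|J|)%N) #|bad p n th s (2 * k).-1 J|)%:R).
    by rewrite ler_nat leq_card_bigcup.
  rewrite natr_sum; apply: ler_sum => J sJ.
  apply: (le_trans (card_bad_le p p_pr n th s (2 * k).-1 J th0 (ltnW sJ))).
  apply: ler_pM => //.
    by rewrite invr_ge0 exprn_ge0// ltW.
  rewrite lef_pV2 ?posrE ?exprn_gt0// ler_wiXn2l ?(ltW th0)//.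
  by rewrite (leq_trans (leq_subr _ _))// -[leqRHS]card_ord max_card.
apply: (@le_trans _ _ (2 ^+ n * (4 ^+ n / th ^+ n))).
  rewrite sumr_const -[leLHS]mulr_natl ler_wpM2r//.
    by rewrite divr_ge0 ?exprn_ge0// ltW.
  rewrite -natrX ler_nat; apply: (leq_trans (max_card _)).
  by rewrite -cardsT -powersetT card_powerset cardsT card_ord.
rewrite -expr_div_n -exprMn lerXn2r ?nnegrE//.
  by rewrite mulr_ge0// divr_ge0// ltW.
have -> : 2 * (4 / th) = 64 * growth_const / rho / rt.
  by rewrite /th; field; rewrite !gt_eqF.
by do 2! [apply: ler_wpM2r; first by rewrite invr_ge0 ltW].
Qed.
End Main.

Theorem theorem1p2 (R : realType) (Cxi : R) (hCxi : 1 <= Cxi) :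
  exists C' : R, 1 <= C' /\
  forall (d : measure_display) (Omega : measurableType d) (P : probability Omega R)
         (xi : nat -> Omega -> R[i]),
    iid_complex P xi -> good P xi Cxi ->
  forall (n s k : nat) (rho : R) (p : nat),
    0 < rho < 1 ->
    1000 * Cxi <= k%:R -> k%:R <= Num.sqrt (s%:R : R) -> Num.sqrt (s%:R : R) <= s%:R ->
    s%:R <= n%:R / ln (n%:R : R) ->
    rho >= C' * Num.max (expR (- (s%:R / k%:R))) ((s%:R : R) `^ (- (k%:R / 4))) ->
    prime p -> odd p ->
    C' / rho <= p%:R -> p%:R <= (2 : R) `^ (n%:R / s%:R) ->
    (#|phi_image p n (Vrho P xi n rho)|)%:R
      <= (5 * n%:R * p%:R ^+ 2 / s%:R) ^+ s
         + (C' / rho / Num.sqrt (s%:R / k%:R : R)) ^+ n.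
Proof.
have b0 := subgroup_const_gt0 Cxi hCxi; have t0 := tail_const_gt0 Cxi.
have g0 := growth_const_gt0 Cxi hCxi.
(* A sum of positive terms, so that it dominates 1 and the three thresholds at once. *)
exists (1 + 4 * subgroup_const Cxi + 4 * tail_const Cxi + 64 * growth_const Cxi).
set C' := (X in 1 <= X /\ _).
have C'1 : 1 <= C' by rewrite /C'; lra.
split=> // d Omega P xi iid gd n s k rho p /andP[rho0 _] kC ks _ sn hmax p_pr _ hp p2.
have C'0 : 0 <= C' by lra.
apply: (card_phi_image_le P xi Cxi iid gd hCxi p p_pr n rho C' s k) => //.
- by rewrite /C'; lra.
- by rewrite /C'; lra.
- by rewrite /C'; lra.
- by apply: le_trans hmax; rewrite ler_wpM2l// le_max lexx.
- by apply: le_trans hmax; rewrite ler_wpM2l// le_max lexx orbT.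
Qed.
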